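(* Let $\vec X_1,\dots,\vec X_n$ be drawn from a strictly stationary sequence of continuous $d$-dimensional random vectors with continuous margins $F_1,\dots,F_d$ and copula $C$, and let $\vec U_i=(F_1(X_{i1}),\dots,F_d(X_{id}))$. Assume: (i) $(\vec U_i)_{i\in\mathbb{Z}}$ is strictly stationary and $\tilde{\mathbb{B}}_n$ converges weakly in $\ell^\infty([0,1]^{d+1})$ to a tight centered Gaussian process $\mathbb{B}_C$ concentrated on the set of $\alpha\in\mathcal C([0,1]^{d+1})$ such that $\alpha(s,\vec u)=0$ whenever one of the components of $(s,\vec u)$ is $0$, and $\alpha(s,1,\dots,1)=0$ for all $s\in(0,1]$; (ii) for each $j\in\{1,\dots,d\}$ the partial derivative $\dot C_j=\partial C/\partial u_j$ exists and is continuous on $\{\vec u\in[0,1]^d:u_j\in(0,1)\}$; (iii) for each $j\in\{1,\dots,d\}$, with probability one there are no ties among $X_{1j},\dots,X_{nj}$. Then $$\sup_{(s,t,\vec u)\in\Delta\times[0,1]^d}|\mathbb{C}_n(s,t,\vec u)-\tilde{\mathbb{C}}_n(s,t,\vec u)|\to0\ \text{in probability},$$ where $\tilde{\mathbb{C}}_n(s,t,\vec u)=\{\tilde{\mathbb{B}}_n(t,\vec u)-\tilde{\mathbb{B}}_n(s,\vec u)\}-\sum_{j=1}^d\dot C_j(\vec u)\{\tilde{\mathbb{B}}_n(t,\vec u^{(j)})-\tilde{\mathbb{B}}_n(s,\vec u^{(j)})\}$. Consequently $\mathbb{C}_n\leadsto\mathbb{C}_C$ in $\ell^\infty(\Delta\times[0,1]^d)$,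 where $$\mathbb{C}_C(s,t,\vec u)=\{\mathbb{B}_C(t,\vec u)-\mathbb{B}_C(s,\vec u)\}-\sum_{j=1}^d\dot C_j(\vec u)\{\mathbb{B}_C(t,\vec u^{(j)})-\mathbb{B}_C(s,\vec u^{(j)})\}.$$
   Context: $\Delta=\{(s,t)\in[0,1]^2:s\le t\}$; $\lfloor y\rfloor$ is the integer part. $\tilde{\mathbb{B}}_n(s,\vec u)=n^{-1/2}\sum_{i=1}^{\lfloor ns\rfloor}\{\mathbf 1(\vec U_i\le\vec u)-C(\vec u)\}$ for $(s,\vec u)\in[0,1]^{d+1}$. For $1\le k\le l\le n$, let $R^{k:l}_{ij}$ be the rank of $X_{ij}$ among $X_{kj},\dots,X_{lj}$, $\hat U^{k:l}_{ij}=R^{k:l}_{ij}/(l-k+1)$ and $\hat{\vec U}^{k:l}_i=(\hat U^{k:l}_{i1},\dots,\hat U^{k:l}_{id})$. The two-sided sequential empirical copula process is $\mathbb{C}_n(s,t,\vec u)=n^{-1/2}\sum_{i=\lfloor ns\rfloor+1}^{\lfloor nt\rfloor}\{\mathbf 1(\hat{\vec U}^{\lfloor ns\rfloor+1:\lfloor nt\rfloor}_i\le\vec u)-C(\vec u)\}$ for $(s,t,\vec u)\in\Delta\times[0,1]^d$ (an empty sum is $0$). $\dot C_j$ is set to $0$ on $\{\vec u:u_j\in\{0,1\}\}$. For $\vec u\in[0,1]^d$, $\vec u^{(j)}$ is the vector whose $j$th component is $u_j$ and all other components equal $1$. $\leadsto$ is weak convergence in the Hoffmann-Jørgensen sense;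 $\mathcal C(T)$ denotes continuous functions on $T$. *)

(* Defs.v *)
From HB Require Import structures.
From mathcomp Require Import all_boot all_order all_algebra.
From mathcomp Require Import all_classical all_reals all_analysis.
Set Implicit Arguments. Unset Strict Implicit. Unset Printing Implicit Defensive.
Import Order.TTheory GRing.Theory Num.Theory.
Import numFieldNormedType.Exports.
Local Open Scope classical_set_scope.
Local Open Scope ring_scope.

Definition outer_prob {R : realType} {dT} {T : measurableType dT}
  (P : probability T R) (A : set T) : \bar R :=
  ereal_inf [set P B | B in [set B | measurable B /\ A `<=` B]].

(* E^* Y = inf { E U : U measurable, U >= Y } (used only for bounded Y) *)
Definition outer_expect {R : realType} {dT} {T : measurableType dT}
  (P : probability T R) (Y : T -> R) : \bar R :=
  ereal_inf [set (\int[P]_w (U w)%:E)%E |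
             U in [set U : T -> R | measurable_fun setT U /\ forall w, Y w <= U w]].

Definition bounded_on {R : realType} {I : Type} (D : set I) (f : I -> R) :=
  exists M : R, forall t, D t -> `|f t| <= M.

Definition supdist_lt {R : realType} {I : Type} (D : set I) (f g : I -> R) (delta : R) :=
  exists eta : R, eta < delta /\ forall t, D t -> `|f t - g t| <= eta.

Definition BC_linfty {R : realType} {I : Type} (D : set I) (h : (I -> R) -> R) :=
  (exists M : R, forall f, `|h f| <= M) /\
  (forall f, bounded_on D f -> forall e : R, 0 < e ->
     exists delta : R, 0 < delta /\
       forall g, bounded_on D g -> supdist_lt D f g delta -> `|h f - h g| < e).

Definition weak_conv_linfty {R : realType} {I : Type} (D : set I)
  {dT} {T : measurableType dT} (P : probability T R) (Xn : nat -> T -> I -> R)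
  {dT'} {T' : measurableType dT'} (P' : probability T' R) (X : T' -> I -> R) :=
  forall h, BC_linfty D h ->
    (fun n => outer_expect P (fun w => h (Xn n w))) @ \oo
      --> outer_expect P' (fun w => h (X w)).

Definition sup_cvg_prob0 {R : realType} {I : Type} (D : set I)
  {dT} {T : measurableType dT} (P : probability T R) (Z : nat -> T -> I -> R) :=
  forall e : R, 0 < e ->
    (fun n => outer_prob P [set w | exists t, D t /\ e < `|Z n w t|]) @ \oo --> 0%E.

Definition centered_normal {R : realType} {dT} {T : measurableType dT}
  (P : probability T R) (Y : T -> R) :=
  (forall A : set R, measurable A -> P (Y @^-1` A) = \d_(0 : R) A) \/
  (exists s : R, 0 < s /\
     forall A : set R, measurable A -> P (Y @^-1` A) = normal_prob 0 s A).

Definition centered_gaussian_process {R : realType} {I : Type} (D : set I)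
  {dT} {T : measurableType dT} (P : probability T R) (B : T -> I -> R) :=
  (forall t, D t -> measurable_fun setT (fun w => B w t)) /\
  (forall (k : nat) (ts : 'I_k -> I) (a : 'I_k -> R), (forall i, D (ts i)) ->
     centered_normal P (fun w => \sum_(i < k) a i * B w (ts i))).

Definition vle {R : realType} {d : nat} (x y : 'rV[R]_d) : bool :=
  [forall j, x ord0 j <= y ord0 j].

Definition unit_cube {R : realType} {d : nat} : set 'rV[R]_d :=
  [set u | forall j, 0 <= u ord0 j <= 1].

Definition D1 {R : realType} {d : nat} : set (R * 'rV[R]_d) :=
  [set p | 0 <= p.1 <= 1 /\ unit_cube p.2].

Definition D2 {R : realType} {d : nat} : set (R * R * 'rV[R]_d) :=
  [set p | 0 <= p.1.1 /\ p.1.1 <= p.1.2 /\ p.1.2 <= 1 /\ unit_cube p.2].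

Definition setc {R : realType} {d : nat} (u : 'rV[R]_d) (j : 'I_d) (x : R) : 'rV[R]_d :=
  \row_k (if k == j then x else u ord0 k).

Definition upj {R : realType} {d : nat} (u : 'rV[R]_d) (j : 'I_d) : 'rV[R]_d :=
  \row_k (if k == j then u ord0 j else 1).

Definition fl {R : realType} (n : nat) (s : R) : nat := Num.truncn (n%:R * s).

(* The data, margins, copula, processes (observations indexed i >= 1)  *)

Definition margin {R : realType} {dT} {T : measurableType dT} {d : nat}
  (P : probability T R) (X : nat -> T -> 'rV[R]_d) (j : 'I_d) (x : R) : R :=
  fine (P [set w | X 1%N w ord0 j <= x]).

Definition Uvec {R : realType} {dT} {T : measurableType dT} {d : nat}
  (P : probability T R) (X : nat -> T -> 'rV[R]_d) (i : nat) (w : T) : 'rV[R]_d :=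
  \row_j margin P X j (X i w ord0 j).

Definition strictly_stationary {R : realType} {dT} {T : measurableType dT} {d : nat}
  (P : probability T R) (X : nat -> T -> 'rV[R]_d) :=
  (forall i j, measurable_fun setT (fun w => X i w ord0 j)) /\
  forall (k m : nat) (x : 'I_k -> 'rV[R]_d),
    P [set w | forall i : 'I_k, vle (X (i + 1 + m)%N w) (x i)] =
    P [set w | forall i : 'I_k, vle (X (i + 1)%N w) (x i)].

Definition Btilde {R : realType} {dT} {T : measurableType dT} {d : nat}
  (U : nat -> T -> 'rV[R]_d) (C : 'rV[R]_d -> R) (n : nat) (w : T)
  (p : R * 'rV[R]_d) : R :=
  (Num.sqrt n%:R)^-1 *
    \sum_(1 <= i < (fl n p.1).+1) ((vle (U i w) p.2)%:R - C p.2).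

Definition rnk {R : realType} {T : Type} {d : nat}
  (X : nat -> T -> 'rV[R]_d) (k l i : nat) (j : 'I_d) (w : T) : nat :=
  count (fun m => X m w ord0 j <= X i w ord0 j) (index_iota k l.+1).

Definition Uhat {R : realType} {T : Type} {d : nat}
  (X : nat -> T -> 'rV[R]_d) (k l i : nat) (w : T) : 'rV[R]_d :=
  \row_j ((rnk X k l i j w)%:R / (l.+1 - k)%:R).

Definition Cn {R : realType} {T : Type} {d : nat}
  (X : nat -> T -> 'rV[R]_d) (C : 'rV[R]_d -> R) (n : nat) (w : T)
  (p : R * R * 'rV[R]_d) : R :=
  let a := fl n p.1.1 in let b := fl n p.1.2 in
  (Num.sqrt n%:R)^-1 *
    \sum_(a.+1 <= i < b.+1) ((vle (Uhat X a.+1 b i w) p.2)%:R - C p.2).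

Definition Cmap {R : realType} {d : nat} (Cdot : 'I_d -> 'rV[R]_d -> R)
  (alpha : R * 'rV[R]_d -> R) (p : R * R * 'rV[R]_d) : R :=
  let s := p.1.1 in let t := p.1.2 in let u := p.2 in
  (alpha (t, u) - alpha (s, u)) -
  \sum_(j < d) Cdot j u * (alpha (t, upj u j) - alpha (s, upj u j)).

Definition boundary_cont_set {R : realType} {d : nat} : set (R * 'rV[R]_d -> R) :=
  [set alpha | {within D1, continuous alpha} /\
     (forall p, D1 p -> (p.1 = 0 \/ exists j, p.2 ord0 j = 0) -> alpha p = 0) /\
     (forall s, 0 < s <= 1 -> alpha (s, const_mx 1) = 0)].

(* Main.v *)
(* Let U_{a:b} be the sub-sample a < i <= b, m = b - a, and D = B(t,.) - B(s,.) the
   increment of the sequential process.  In each coordinate j the event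
   {rank_ij <= m u_j} coincides, up to ties, with {U_ij <= v_j} for an empirical
   quantile v_j, and C having uniform margins turns this into
   (m / sqrt n) (v_j - u_j) = - D(v^(j)) + O(ties / sqrt n).  A first order expansion
   of C at u then gives the approximation of C_n by a linear image of B.  Everything is
   deterministic once B has a small modulus of continuity (which also bounds the ties,
   since a tie is a jump of B) and is small where its limit vanishes: for m / n small,
   D is small, and for m / n bounded below, v - u = O(1 / sqrt n).  Near u_j = 0 or 1,
   where the partial derivatives need not be continuous, D(u^(j)) is small.

   Weak convergence provides these properties of B with large outer probability, via
   a truncated modulus of continuity, itself a bounded continuous functional.  The
   second assertion follows by comparing h with its Lipschitz majorants.  In both
   steps the limit expectations decrease, so functionals of B_C must be measurable;
   this holds because continuous paths are uniform limits of countably valued ones. *)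
Require Import Defs.
From HB Require Import structures.
From mathcomp Require Import all_boot all_order all_algebra.
From mathcomp Require Import all_classical all_reals all_analysis.
From mathcomp Require Import measurable_realfun ring lra.
Set Implicit Arguments. Unset Strict Implicit. Unset Printing Implicit Defensive.
Import Order.TTheory GRing.Theory Num.Theory.
Import numFieldNormedType.Exports.
Local Open Scope classical_set_scope.
Local Open Scope ring_scope.

(** * Empirical quantiles *)

Lemma exists_maximal (R : realDomainType) (I : eqType) (x : I -> R) (L : seq I) :
  L != [::] -> exists2 i, i \in L & forall k, k \in L -> x k <= x i.
Proof.
elim: L => // a [|b L] IH _.
  by exists a; rewrite ?mem_head // => k; rewrite inE => /eqP ->.
have [//|i iL xi] := IH.
have [xia|/ltW xai] := leP (x i) (x a).
  exists a; rewrite ?mem_head // => k; rewrite inE => /orP[/eqP -> //|/xi xk].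
  exact: le_trans xk xia.
exists i; first by rewrite inE iL orbT.
by move=> k; rewrite inE => /orP[/eqP -> //|/xi].
Qed.

Section RankThreshold.
Variables (R : realDomainType) (I : eqType) (L : seq I) (x y : I -> R).
Variables (r tau : nat).
Hypothesis xy_homo : forall i k, x i <= x k -> y i <= y k.
Hypothesis y_ge0 : forall i, 0 <= y i.
Hypothesis r_le : (r <= size L)%N.
Hypothesis ties : forall v, (count (fun i => y i == v) L <= tau)%N.

Let rank i := count (fun m => x m <= x i) L.
Let S := [seq i <- L | (rank i <= r)%N].

Let rank_homo i k : x i <= x k -> (rank i <= rank k)%N.
Proof. by move=> ik; apply: sub_count => m mi; exact: le_trans mi ik. Qed.

(** Among the indices of rank above [r], take one, [i], with smallest [x]. More than [r] indices
    satisfy [x k <= x i]; each of them lies in [S] or has [x k = x i], and the latter are among the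
    at most [tau] indices with [y k = y i]. *)
Let size_S_ge : (r <= size S + tau)%N.
Proof.
have [|Ne] := @eqVneq (seq I) [seq i <- L | ~~ (rank i <= r)%N] [::].
  move=> /eqP; rewrite -size_eq0 size_filter -leqn0 leqNgt -has_count -all_predC.
  move=> H; suff -> : S = L by rewrite (leq_trans r_le) ?leq_addr.
  by apply/all_filterP; apply: sub_all H => i /=; rewrite negbK.
have [i] := exists_maximal (fun i => - x i) Ne.
rewrite mem_filter -ltnNge => /andP[ri iL] imin.
apply: leq_trans (ltnW ri) _.
rewrite /S size_filter; apply: leq_trans (leq_add (leqnn _) (ties (y i))).
rewrite -count_predUI; apply: leq_trans (leq_addr _ _).
rewrite /rank; apply: (@leq_trans (count (predI (mem L) (fun m => x m <= x i)) L)).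
  by rewrite leq_eqVlt; apply/orP; left; apply/eqP/eq_in_count => k /= ->.
apply: sub_count => k /= /andP[kL xki]; have [//|nk] := boolP (rank k <= r)%N.
have : k \in [seq i <- L | ~~ (rank i <= r)%N] by rewrite mem_filter nk.
move=> /imin; rewrite lerN2 => xik.
by rewrite eq_le !xy_homo.
Qed.

(* [v] is the largest [y] value among the indices of rank at most [r], or [0] if there is
   none. *)
Lemma rank_threshold : exists v : R, [/\ v = 0 \/ exists i, v = y i,
  (count (fun i => (rank i <= r)%N != (y i <= v)%R) L <= tau)%N,
  (count (fun i => y i <= v)%R L <= r + tau)%N &
  (r <= count (fun i => y i <= v)%R L + tau)%N].
Proof.
have [v [v0 Sle ltS Sr]] : exists v : R, [/\ v = 0 \/ exists i, v = y i,
    forall i, i \in L -> (rank i <= r)%N -> y i <= v,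
    forall i, y i < v -> (rank i <= r)%N & (size S <= r)%N].
  have [S0|Ne] := eqVneq S [::].
    exists 0; split; [by left| |by move=> i; rewrite ltNge y_ge0|by rewrite S0].
    by move=> i iL ri; have : i \in S by [rewrite mem_filter ri]; rewrite S0.
  have [i] := exists_maximal x Ne; rewrite mem_filter => /andP[ri iL] imax.
  exists (y i); split; first by right; exists i.
  - by move=> k kL rk; apply: xy_homo; apply: imax; rewrite mem_filter rk.
  - move=> k yki; apply: leq_trans ri; apply: rank_homo.
    by rewrite leNgt; apply/negP => /ltW /xy_homo; rewrite leNgt yki.
  - apply: leq_trans ri; rewrite /S size_filter /rank.
    rewrite (@eq_in_count _ _ (predI (mem L) (fun k => rank k <= r)%N)); last first.
      by move=> k /= ->.
    by apply: sub_count => k /= /andP[kL rk]; apply: imax; rewrite mem_filter rk.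
(* The two conditions can disagree only where [y i = v]: rank at most [r] forces [y i <= v], while
   [y i < v] forces rank at most [r]. *)
have diff : (count (fun i => (rank i <= r)%N != (y i <= v)%R) L <= tau)%N.
  apply: leq_trans (ties v).
  rewrite (@eq_in_count _ _ (predI (mem L) (fun i => (rank i <= r)%N != (y i <= v)))).
    apply: sub_count => k /= /andP[kL].
    have := Sle k kL; case: (ltgtP (y k) v) => [/ltS -> //||//].
    by case: (rank k <= r)%N => // ? /(_ isT).
  by move=> k /= ->.
exists v; split => //.
- apply: (leq_trans _ (leq_add Sr diff)); rewrite /S size_filter -count_predUI.
  apply: leq_trans (leq_addr _ _); apply: sub_count => k /=.
  by case: (rank k <= r)%N => //= ->.
- apply: leq_trans size_S_ge _; rewrite leq_add2r /S size_filter.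
  rewrite (@eq_in_count _ _ (predI (mem L) (fun k => rank k <= r)%N)); last first.
    by move=> k /= ->.
  by apply: sub_count => k /= /andP[kL]; exact: Sle.
Qed.

End RankThreshold.

(** * The deterministic approximation *)

Definition close_pts {R : realType} {d : nat} (delta : R) (p q : R * 'rV[R]_d) :=
  `|p.1 - q.1| < delta /\ forall j, `|p.2 ord0 j - q.2 ord0 j| < delta.

(* The points at which the limit paths vanish. *)
Definition null_pt {R : realType} {d : nat} (p : R * 'rV[R]_d) :=
  [\/ p.1 = 0, exists j, p.2 ord0 j = 0 | p.2 = const_mx 1].

Definition tame {R : realType} {d : nat} (delta e : R) (alpha : R * 'rV[R]_d -> R) :=
  (forall p q, D1 p -> D1 q -> close_pts delta p q -> `|alpha p - alpha q| <= e) /\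
  (forall p, D1 p -> null_pt p -> `|alpha p| <= e).

(* Chaining from [s = 0] in steps of length [delta / 2]. *)
Lemma tame_bounded (R : realType) (d : nat) (delta e : R) (alpha : R * 'rV[R]_d -> R) p :
  0 < delta -> 0 <= e -> tame delta e alpha -> D1 p ->
  `|alpha p| <= e * (Num.truncn (2 / delta)).+2%:R.
Proof.
move=> d0 e0 [al1 al2]; case: p => s u [/= s01 u01].
have step k : forall s, 0 <= s <= 1 -> s <= k%:R * (delta / 2) ->
    `|alpha (s, u)| <= e * k.+1%:R.
  elim: k => [|k IH] {s01} s s01 sk.
    rewrite mulr1; apply: al2 => //; apply: Or31 => /=.
    by apply/eqP; rewrite eq_le; case/andP: s01 => -> _; rewrite mul0r in sk; rewrite sk.
  have [sk'|sk'] := leP s (k%:R * (delta / 2)).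
    by apply: le_trans (IH _ s01 sk') _; rewrite ler_wpM2l// ler_nat.
  have s'0 : 0 <= s - delta / 2 -> 0 <= s - delta / 2 <= 1 by move: s01 d0; lra.
  have [s'neg|s'pos] := ltP (s - delta / 2) 0.
    have z01 : 0 <= (0 : R) <= 1 by lra.
    have zk : 0 <= k%:R * (delta / 2) by rewrite mulr_ge0// divr_ge0// ltW.
    have A := IH 0 z01 zk.
    have B : `|alpha (s, u) - alpha (0, u)| <= e.
      apply: al1 => //; split => [/=|j /=]; last by rewrite subrr normr0.
      by rewrite ger0_norm; lra.
    rewrite -[k.+2]addn1 natrD mulrDr mulr1.
    by have := ler_normD (alpha (0, u)) (alpha (s, u) - alpha (0, u));
      rewrite [alpha (0, u) + _]addrC subrK; lra.
  have zk : s - delta / 2 <= k%:R * (delta / 2).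
    by move: sk; rewrite -natr1; lra.
  have A := IH _ (s'0 s'pos) zk.
  have B : `|alpha (s, u) - alpha (s - delta / 2, u)| <= e.
    apply: al1 => //; first by split => //; exact: s'0.
    split => [/=|j /=]; last by rewrite subrr normr0.
    by rewrite ger0_norm; lra.
  rewrite -[k.+2]addn1 natrD mulrDr mulr1.
  by have := ler_normD (alpha (s - delta / 2, u)) (alpha (s, u) - alpha (s - delta / 2, u));
    rewrite [alpha (s - delta / 2, u) + _]addrC subrK; lra.
(* Here [k] is the integer part of [2 / delta] plus one, enough steps to reach every [s <= 1]; the
   remaining unit of the bound pays for the value at [s = 0]. *)
apply: step => //.
have := truncnS_gt (2 / delta) => h.
have : 2 / delta * (delta / 2) <= (Num.truncn (2 / delta)).+1%:R * (delta / 2).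
  by apply: ler_wpM2r; [lra|exact: ltW].
have -> : 2 / delta * (delta / 2) = 1 by field; rewrite gt_eqF.
by move: s01; lra.
Qed.

(** The coordinates of [u] are replaced by those of [v] one at a time, with a mean value step for
    each. The points [w j] need not lie on the segment from [u] to [v], but no coordinate of theirs
    is farther from [u] than that of [v]. *)
Lemma telescope_partials (R : realType) (d : nat) (C : 'rV[R]_d -> R)
    (Cdot : 'I_d -> 'rV[R]_d -> R) (u v : 'rV[R]_d) :
  (forall u j (y : R), unit_cube u -> 0 <= y <= 1 -> exists xi : R,
     [/\ `|xi - u ord0 j| <= `|y - u ord0 j|, 0 <= xi <= 1 &
       C (setc u j y) - C u = Cdot j (setc u j xi) * (y - u ord0 j)]) ->
  unit_cube u -> unit_cube v ->
  exists w : 'I_d -> 'rV[R]_d,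
    [/\ forall j, unit_cube (w j),
        forall j k, `|w j ord0 k - u ord0 k| <= `|v ord0 k - u ord0 k| &
        C v - C u = \sum_j Cdot j (w j) * (v ord0 j - u ord0 j)].
Proof.
move=> mvt u01 v01.
pose hyb i : 'rV[R]_d := \row_k (if (k < i)%N then v ord0 k else u ord0 k).
have hyb01 i : unit_cube (hyb i) by move=> k; rewrite mxE; case: ifP.
have H (j : 'I_d) : exists wj : 'rV[R]_d,
   [/\ unit_cube wj, forall k, `|wj ord0 k - u ord0 k| <= `|v ord0 k - u ord0 k| &
     C (hyb j.+1) - C (hyb j) = Cdot j wj * (v ord0 j - u ord0 j)].
  have [xi [x1 x2 x3]] := mvt (hyb j) j (v ord0 j) (hyb01 j) (v01 j).
  have hj : hyb j ord0 j = u ord0 j by rewrite mxE ltnn.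
  rewrite hj in x1 x3.
  exists (setc (hyb j) j xi); split.
  - by move=> k; rewrite mxE; case: ifP => // _; exact: hyb01.
  - move=> k; rewrite mxE; case: eqP => [->//|_].
    by rewrite mxE; case: ifP => //; rewrite subrr normr0.
  - rewrite -x3; congr (C _ - _); apply/rowP => k; rewrite !mxE.
    have [->|kj] := eqVneq k j; first by rewrite ltnSn.
    by rewrite ltnS leq_eqVlt val_eqE (negPf kj).
have [w Hw] := choice H.
exists w; split; [by move=> j; case: (Hw j)|by move=> j; case: (Hw j)|].
have Ev : v = hyb d by apply/rowP => k; rewrite mxE ltn_ord.
have Eu : u = hyb 0%N by apply/rowP => k; rewrite mxE.
have -> : C v - C u = C (hyb d) - C (hyb 0%N) by rewrite -Ev -Eu.
rewrite -(telescope_sumr (fun i => C (hyb i)) (leq0n d)) big_mkord.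
by apply: eq_bigr => j _; case: (Hw j).
Qed.

Lemma natr_count (R : pzSemiRingType) (I : Type) (a : pred I) (s : seq I) :
  (count a s)%:R = \sum_(i <- s) (a i)%:R :> R.
Proof. by elim: s => [|i s IH]; rewrite ?big_nil// big_cons natrD IH. Qed.

Section Deterministic.
Variables (R : realType) (d : nat) (C : 'rV[R]_d -> R) (Cdot : 'I_d -> 'rV[R]_d -> R).
Variables (F : 'I_d -> R -> R) (dT : measure_display) (T : measurableType dT).
Variables (X U : nat -> T -> 'rV[R]_d).
Hypothesis F01 : forall j x, 0 <= F j x <= 1.
Hypothesis F_homo : forall j, {homo F j : x y / x <= y}.
Hypothesis U_F : forall i w j, U i w ord0 j = F j (X i w ord0 j).
Hypothesis C_margin : forall u (j : 'I_d), unit_cube u -> C (upj u j) = u ord0 j.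
Hypothesis Cdot_le1 : forall u (j : 'I_d), unit_cube u -> `|Cdot j u| <= 1.
Hypothesis C_mvt : forall u j (y : R), unit_cube u -> 0 <= y <= 1 -> exists xi : R,
     [/\ `|xi - u ord0 j| <= `|y - u ord0 j|, 0 <= xi <= 1 &
       C (setc u j y) - C u = Cdot j (setc u j xi) * (y - u ord0 j)].

Let cnt (a b : nat) w u : R := \sum_(a.+1 <= i < b.+1) (vle (U i w) u)%:R.

Lemma unit_cube_upj (u : 'rV[R]_d) j : unit_cube u -> unit_cube (upj u j).
Proof. by move=> u01 k; rewrite mxE; case: ifP => _; [exact: u01|lra]. Qed.

Let Btilde_incr n w s t u : (fl n s <= fl n t)%N ->
  Btilde U C n w (t, u) - Btilde U C n w (s, u) =
  (Num.sqrt n%:R)^-1 * (cnt (fl n s) (fl n t) w u - (fl n t - fl n s)%:R * C u).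
Proof.
move=> st; rewrite /Btilde /= -mulrBr; congr (_ * _).
rewrite (big_cat_nat (n := (fl n s).+1))//= addrAC subrr add0r sumrB.
by rewrite sumr_const_nat subSS mulr_natl.
Qed.

(** * The approximation between two grid times [a / n] and [b / n] *)

Section Grid.
Variables (n a b : nat) (w : T) (delta e M rho : R).
Let q : R := Num.sqrt n%:R.
Let m : nat := (b - a)%N.
Let alpha := Btilde U C n w.
Hypotheses (n0 : (0 < n)%N) (ab : (a <= b)%N) (bn : (b <= n)%N).
Hypotheses (delta0 : 0 < delta) (e0 : 0 < e).
Hypothesis alpha_tame : tame delta e alpha.
Hypothesis alpha_M : forall p, D1 p -> `|alpha p| <= M.
Hypothesis q_large1 : 1 <= e * q.

Let D u := alpha (b%:R / n%:R, u) - alpha (a%:R / n%:R, u).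
Let L := index_iota a.+1 b.+1.

Let nR : 0 < n%:R :> R. Proof. by rewrite ltr0n. Qed.
Let q0 : 0 < q. Proof. by rewrite sqrtr_gt0. Qed.
Let qq : q * q = n%:R. Proof. by rewrite -expr2 sqr_sqrtr// ltW. Qed.
Let mn : (m <= n)%N. Proof. exact: leq_trans (leq_subr _ _) bn. Qed.

Let fl_grid k : fl n (k%:R / n%:R : R) = k.
Proof. by rewrite /fl mulrC divfK ?gt_eqF// natrK. Qed.

Let grid01 k : (k <= n)%N -> 0 <= (k%:R / n%:R : R) <= 1.
Proof. by move=> kn; rewrite divr_ge0//= ler_pdivrMr// mul1r ler_nat. Qed.

Let b01 := grid01 bn.
Let a01 := grid01 (leq_trans ab bn).

Let D_cnt u : q * D u = cnt a b w u - m%:R * C u.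
Proof.
rewrite /D /alpha Btilde_incr !fl_grid // mulrA -/q divff ?mul1r// gt_eqF//.
Qed.

Let D_small u : unit_cube u -> m%:R < delta * n%:R -> `|D u| <= e.
Proof.
move=> u01 md; apply: (proj1 alpha_tame) => //; split => /= [|j]; last first.
  by rewrite subrr normr0.
rewrite -mulrBl -natrB// ger0_norm ?divr_ge0//.
by rewrite ltr_pdivrMr.
Qed.

Let D_close u u' : unit_cube u -> unit_cube u' ->
  (forall k, `|u ord0 k - u' ord0 k| < delta) -> `|D u - D u'| <= 2 * e.
Proof.
move=> u01 u'01 uu'.
have B : `|alpha (b%:R / n%:R, u) - alpha (b%:R / n%:R, u')| <= e.
  by apply: (proj1 alpha_tame) => //; split => //=; rewrite subrr normr0.
have A : `|alpha (a%:R / n%:R, u) - alpha (a%:R / n%:R, u')| <= e.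
  by apply: (proj1 alpha_tame) => //; split => //=; rewrite subrr normr0.
rewrite /D; move: A B; rewrite !ler_norml; lra.
Qed.

Let D_null u : unit_cube u -> (exists j, u ord0 j = 0) \/ u = const_mx 1 ->
  `|D u| <= 2 * e.
Proof.
move=> u01 hu.
have B : `|alpha (b%:R / n%:R, u)| <= e.
  by apply: (proj2 alpha_tame) => //; case: hu => h; [apply: Or32|apply: Or33].
have A : `|alpha (a%:R / n%:R, u)| <= e.
  by apply: (proj2 alpha_tame) => //; case: hu => h; [apply: Or32|apply: Or33].
rewrite /D; move: A B; rewrite !ler_norml; lra.
Qed.

Let D_bounded u : unit_cube u -> `|D u| <= 2 * M.
Proof.
move=> u01.
have B : `|alpha (b%:R / n%:R, u)| <= M by exact: alpha_M.
have A : `|alpha (a%:R / n%:R, u)| <= M by exact: alpha_M.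
rewrite /D; move: A B; rewrite !ler_norml; lra.
Qed.

Let axis j v : 'rV[R]_d := upj (const_mx v) j.

Let axis01 j v : 0 <= v <= 1 -> unit_cube (axis j v).
Proof. by move=> v01; apply: unit_cube_upj => k; rewrite mxE. Qed.

Let axis_close j v v' : `|v - v'| < delta ->
  forall k, `|axis j v ord0 k - axis j v' ord0 k| < delta.
Proof. by move=> vv' k; rewrite !mxE; case: ifP => _; rewrite ?subrr ?normr0. Qed.

Let upjE (u : 'rV[R]_d) j : upj u j = axis j (u ord0 j).
Proof. by apply/rowP => k; rewrite !mxE; case: eqP => // ->. Qed.

(** If [u_j] is near 0 or 1, then [upj u j] is near a point with a zero coordinate or near the
    all-ones vector. Smallness there costs [2 * e], and moving back to [upj u j] another [2 * e]. *)
Let D_edge u j : unit_cube u -> u ord0 j < delta \/ 1 - delta < u ord0 j ->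
  `|D (upj u j)| <= 4 * e.
Proof.
move=> u01 uj; rewrite upjE; have uj01 := u01 j.
have [v [v01 uv vn]] : exists v, [/\ 0 <= v <= 1, `|u ord0 j - v| < delta &
    `|D (axis j v)| <= 2 * e].
  case: uj => uj.
    exists 0; have z : 0 <= (0 : R) <= 1 by lra.
    split => //; first by rewrite subr0 ger0_norm//; case/andP: uj01.
    apply: D_null; [exact: axis01|left; exists j].
    by rewrite !mxE eqxx.
  exists 1; have z : 0 <= (1 : R) <= 1 by lra.
  split => //; first by rewrite ler0_norm; lra.
  apply: D_null; [exact: axis01|right].
  by apply/rowP => k; rewrite !mxE; case: ifP.
have := D_close (axis01 j uj01) (axis01 j v01) (axis_close j uv).
by move: vn; rewrite !ler_norml; lra.
Qed.

(** The other coordinates of [U] never exceed 1, so only the [j]th one is constrained on the axis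
    point, and uniform margins make the centering equal to [m v]. *)
Let count_axis j v : 0 <= v <= 1 ->
  (count (fun i => U i w ord0 j <= v) L)%:R = q * D (axis j v) + m%:R * v.
Proof.
move=> v01; rewrite D_cnt C_margin; last by move=> k; rewrite mxE.
rewrite mxE subrK /cnt natr_count; apply: eq_bigr => i _; rewrite /vle.
suff -> : [forall k, U i w ord0 k <= axis j v ord0 k] = (U i w ord0 j <= v) by [].
  apply/forallP/idP => [/(_ j)|Uv k]; first by rewrite !mxE eqxx.
  rewrite !mxE; case: eqP => [->//|_].
  by rewrite U_F; case/andP: (F01 k (X i w ord0 k)).
Qed.

(** Ties at [v > 0] form a jump of the counting function, at most its increase
    [q (D(v) - D(v')) + m (v - v')] from a nearby [v' < v]. At [v = 0] the count itself is [q D] at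
    a null point. *)
Let ties j v : (count (fun i => U i w ord0 j == v) L)%:R <= 2 * e * q.
Proof.
have eq0 : 0 <= 2 * e * q by rewrite !mulr_ge0// ltW.
have [v01|nv01] := boolP (0 <= v <= 1); last first.
  rewrite (_ : count _ _ = 0%N)//; apply/eqP; rewrite -leqn0 leqNgt -has_count.
  apply/hasPn => i _ /=; apply: contra nv01 => /eqP <-.
  by rewrite U_F.
have [v0|v0] := leP v 0.
  have vz : v = 0 by apply/eqP; rewrite eq_le v0; case/andP: v01.
  apply: (@le_trans _ _ (count (fun i => U i w ord0 j <= v) L)%:R).
    by rewrite ler_nat; apply: sub_count => i /= /eqP ->.
  rewrite count_axis// {2}vz mulr0 addr0 -[2 * e * q]mulrC ler_pM2l//.
  apply: le_trans (ler_norm _) _; apply: D_null; first exact: axis01.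
  by left; exists j; rewrite !mxE eqxx.
apply/ler_addgt0Pr => eps eps0.
(* The first bound on [v - v'] makes [D_close] applicable, the second keeps the drift [m (v - v')]
   below [eps]. *)
pose v' := Num.max 0 (v - Num.min (delta / 2) (eps / n%:R)).
have mn0 : 0 < Num.min (delta / 2) (eps / n%:R) by rewrite lt_min !divr_gt0.
have [md mE] : Num.min (delta / 2) (eps / n%:R) <= delta / 2 /\
    Num.min (delta / 2) (eps / n%:R) <= eps / n%:R by rewrite !ge_min !lexx orbT.
have [v'0 v'v vv'd vv'e] : [/\ 0 <= v', v' < v, v - v' <= delta / 2 & v - v' <= eps / n%:R].
  rewrite /v'; case: (leP 0 (v - Num.min (delta / 2) (eps / n%:R))) => h; split => //; lra.
have v'01 : 0 <= v' <= 1 by lra.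
have cc : (count (fun i => U i w ord0 j == v) L + count (fun i => U i w ord0 j <= v')%R L
    <= count (fun i => U i w ord0 j <= v)%R L)%N.
  rewrite -count_predUI [X in (_ + X)%N](_ : _ = 0%N) ?addn0.
    apply: sub_count => i /= /orP[/eqP ->//|/le_trans]; apply; exact: ltW.
  apply/eqP; rewrite -leqn0 leqNgt -has_count; apply/hasPn => i _ /=.
  by apply/negP => /andP[/eqP ->]; rewrite leNgt v'v.
have := cc; rewrite -(ler_nat R) natrD !count_axis//.
have Dc : `|D (axis j v) - D (axis j v')| <= 2 * e.
  apply: D_close; [exact: axis01|exact: axis01|apply: axis_close].
  by rewrite ger0_norm; lra.
have h1 : q * (D (axis j v) - D (axis j v')) <= 2 * e * q.
  by rewrite mulrC ler_pM2r//; apply: le_trans (ler_norm _) Dc.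
have h2 : m%:R * (v - v') <= eps.
  apply: (@le_trans _ _ (n%:R * (eps / n%:R))).
    by apply: ler_pM => //; [lra|rewrite ler_nat].
  by rewrite mulrC divfK// gt_eqF.
by rewrite mulrBr in h1; rewrite mulrBr in h2; lra.
Qed.

Hypotheses (rho0 : 0 < rho) (rho_delta : rho <= delta).
Hypothesis q_large2 : 2 * M + 3 * e < delta * q * rho.
Hypothesis Cdot_rho : forall j u u', unit_cube u -> unit_cube u' ->
  delta <= u ord0 j <= 1 - delta -> (forall k, `|u ord0 k - u' ord0 k| < rho) ->
  `|Cdot j u - Cdot j u'| * (2 * M) <= e.

(** This is [rank_threshold] with [r] the integer part of [m u_j] and [tau] that of [2 * e * q], the
    bound on ties. In the last estimate ties cost [2 * e * q], and rounding [m u_j] costs at most 1,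
    which is at most [e * q]. *)
Let quantile (u : 'rV[R]_d) (j : 'I_d) : unit_cube u -> exists v, [/\ 0 <= v <= 1,
  (count (fun i => (rnk X a.+1 b i j w <= Num.truncn (m%:R * u ord0 j))%N
                     != (U i w ord0 j <= v)%R) L)%:R <= 2 * e * q &
  `|q * D (axis j v) + m%:R * (v - u ord0 j)| <= 3 * e * q].
Proof.
move=> u01; have uj01 := u01 j.
have mu0 : 0 <= m%:R * u ord0 j by rewrite mulr_ge0//; case/andP: uj01.
pose r := Num.truncn (m%:R * u ord0 j).
have rm : (r <= size L)%N.
  rewrite size_iota subSS -(natrK (R := R) (b - a)); apply: le_truncn.
  by rewrite -[leRHS]mulr1 ler_wpM2l//; case/andP: uj01.
have eq0 : 0 <= 2 * e * q by rewrite !mulr_ge0// ltW.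
have tt v : (count (fun i => U i w ord0 j == v) L <= Num.truncn (2 * e * q))%N.
  by rewrite -(natrK (R := R) (count _ _)); apply: le_truncn; exact: ties.
have XU i k : X i w ord0 j <= X k w ord0 j -> U i w ord0 j <= U k w ord0 j.
  by rewrite !U_F; exact: F_homo.
have U0 i : 0 <= U i w ord0 j by rewrite U_F; case/andP: (F01 j (X i w ord0 j)).
have [v [v0 h1 h2 h3]] := rank_threshold XU U0 rm tt.
have te : (Num.truncn (2 * e * q))%:R <= 2 * e * q by rewrite truncn_le.
have v01 : 0 <= v <= 1 by case: v0 => [->|[i ->]]; [lra|rewrite U_F].
exists v; split => //.
  by apply: le_trans te; rewrite ler_nat.
have r1 : r%:R <= m%:R * u ord0 j by rewrite truncn_le.
have r2 : m%:R * u ord0 j < r%:R + 1 by rewrite natr1 truncnS_gt.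
have := h2; rewrite -(ler_nat R) natrD count_axis// => {}h2.
have := h3; rewrite -(ler_nat R) natrD count_axis// => {}h3.
by move: q_large1 te h2 h3 r1 r2; rewrite ler_norml -/m -/r; lra.
Qed.

(** Error budget: for each coordinate, [2 * e] for replacing the rank event by [U_ij <= v_j] and
    [13 * e] for the linear term; in addition [2 * e] for replacing [D vv] by [D u]. *)
Lemma grid_estimate (u : 'rV[R]_d) : unit_cube u ->
  `| q^-1 * (\sum_(a.+1 <= i < b.+1) ((vle (Uhat X a.+1 b i w) u)%:R - C u)) -
     (D u - \sum_(j < d) Cdot j u * D (upj u j)) | <= (15 * d%:R + 2) * e.
Proof.
move=> u01.
have [v Hv] := choice (fun j => @quantile u j u01).
pose vv : 'rV[R]_d := \row_j v j.
have vv01 : unit_cube vv by move=> j; rewrite mxE; case: (Hv j).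
have [ww [ww01 wwu Cww]] := telescope_partials C_mvt u01 vv01.
pose y j := m%:R * (v j - u ord0 j).
have yD j : `|q * D (upj vv j) + y j| <= 3 * e * q.
  by rewrite upjE [vv _ _]mxE; case: (Hv j).
have M0 : 0 <= 2 * M by apply: le_trans (D_bounded u01).
have yM j : `|y j| <= q * (2 * M + 3 * e).
  have := yD j; have := D_bounded (unit_cube_upj j vv01) => h1 h2.
  have h3 : `|q * D (upj vv j)| <= q * (2 * M) by rewrite normrM gtr0_norm// ler_pM2l.
  rewrite mulrDr [q * (3 * e)]mulrC.
  by move: h2 h3; rewrite !ler_norml; lra.
(* A deviation of at least [rho] would give [|y j| >= delta n rho], which [q_large2] makes larger
   than the bound [yM]. *)
have large j : delta * n%:R <= m%:R -> `|vv ord0 j - u ord0 j| < rho.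
  move=> dm; rewrite mxE ltNge; apply/negP => xr.
  have : delta * n%:R * rho <= `|y j|.
    by rewrite normrM normr_nat; apply: ler_pM => //; [rewrite mulr_ge0// ltW|exact: ltW].
  rewrite -qq => h; have := le_trans h (yM j).
  have -> : delta * (q * q) * rho = q * (delta * q * rho) by ring.
  by rewrite ler_pM2l// leNgt q_large2.
(* Two regimes: for [m < delta n] both increments are small by closeness of the two times; otherwise
   [large] makes the two points close. *)
have D_vu u1 u2 : unit_cube u1 -> unit_cube u2 ->
   (forall k, `|u1 ord0 k - u2 ord0 k| <= `|vv ord0 k - u ord0 k|) -> `|D u1 - D u2| <= 2 * e.
  move=> u101 u201 h; have [md|md] := ltP m%:R (delta * n%:R).
    by have := D_small u101 md; have := D_small u201 md; rewrite !ler_norml; lra.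
  apply: D_close => // k; apply: le_lt_trans (h k) _.
  exact: lt_le_trans (large k md) rho_delta.
(* Three replacements: [y j] by [- q D(vv^(j))] costs [3 * e], [D(vv^(j))] by [D(u^(j))] costs
   [2 * e], and the derivative at [ww j] by the one at [u] costs [8 * e]. *)
have term j : `| q^-1 * (Cdot j (ww j) * y j) + Cdot j u * D (upj u j)| <= 13 * e.
  have E : q^-1 * (Cdot j (ww j) * y j) + Cdot j u * D (upj u j) =
     q^-1 * (Cdot j (ww j) * (q * D (upj vv j) + y j))
     - Cdot j (ww j) * (D (upj vv j) - D (upj u j))
     + (Cdot j u - Cdot j (ww j)) * D (upj u j) by field; rewrite gt_eqF.
  have h1 : `|q^-1 * (Cdot j (ww j) * (q * D (upj vv j) + y j))| <= 3 * e.
    rewrite normrM gtr0_norm ?invr_gt0// mulrC ler_pdivrMr// normrM.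
    rewrite -[leRHS]mul1r; apply: ler_pM => //; exact: Cdot_le1.
  have h2 : `|Cdot j (ww j) * (D (upj vv j) - D (upj u j))| <= 2 * e.
    rewrite normrM -[leRHS]mul1r; apply: ler_pM => //; first exact: Cdot_le1.
    apply: D_vu; [exact: unit_cube_upj|exact: unit_cube_upj|].
    by move=> k; rewrite !mxE; case: eqP => [->//|_]; rewrite subrr normr0.
  (* Either [D(u^(j))] is small, because [m / n] is small or [u_j] is near an endpoint, and the
     derivatives differ by at most 2; or [u_j] is interior and the uniform continuity of the
     derivative outweighs the bound [2 * M] on [D]. *)
  have h3 : `|(Cdot j u - Cdot j (ww j)) * D (upj u j)| <= 8 * e.
    have c2 : `|Cdot j u - Cdot j (ww j)| <= 2.
      have := Cdot_le1 j u01; have := Cdot_le1 j (ww01 j); rewrite !ler_norml; lra.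
    have small : `|D (upj u j)| <= 4 * e -> `|(Cdot j u - Cdot j (ww j)) * D (upj u j)| <= 8 * e.
      move=> hD; rewrite normrM (_ : 8 * e = 2 * (4 * e)); last ring.
      exact: ler_pM.
    have [md|md] := ltP m%:R (delta * n%:R).
      apply: small; apply: le_trans (D_small (unit_cube_upj j u01) md) _.
      by move: e0; lra.
    have [/andP[ul ur]|] := boolP (delta <= u ord0 j <= 1 - delta).
      rewrite normrM; apply: (@le_trans _ _ e); last by move: e0; lra.
      apply: le_trans (_ : `|Cdot j u - Cdot j (ww j)| * (2 * M) <= e); last first.
        apply: Cdot_rho => //; first by rewrite ul.
        by move=> k; rewrite distrC; apply: le_lt_trans (wwu j k) (large k md).
      by apply: ler_wpM2l => //; exact: D_bounded (unit_cube_upj j u01).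
    rewrite negb_and -!ltNge => /orP h; apply: small; exact: D_edge.
  by rewrite E; move: h1 h2 h3; rewrite !ler_norml; lra.
(* Since ranks are integers, the condition [rank / m <= u_j] reads [rank <= truncn (m u_j)]. The two
   indicators differ only if some coordinate disagrees, so disagreements are summed over
   coordinates. *)
have hat : `|\sum_(a.+1 <= i < b.+1) (vle (Uhat X a.+1 b i w) u)%:R - cnt a b w vv|
    <= d%:R * (2 * e * q).
  rewrite /cnt -sumrB; apply: le_trans (ler_norm_sum _ _ _) _.
  apply: (@le_trans _ _ (\sum_(a.+1 <= i < b.+1) \sum_(j < d)
     ((rnk X a.+1 b i j w <= Num.truncn (m%:R * u ord0 j))%N != (U i w ord0 j <= v j)%R)%:R)).
    rewrite !big_nat; apply: ler_sum => i /andP[ai ib].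
    have m0 : (0 < m)%N by rewrite subn_gt0; apply: leq_trans ai _.
    have hatE : vle (Uhat X a.+1 b i w) u =
       [forall j, (rnk X a.+1 b i j w <= Num.truncn (m%:R * u ord0 j))%N].
      apply: eq_forallb => j; rewrite mxE subSS ler_pdivrMr ?ltr0n//.
      rewrite truncn_ge_nat 1?mulrC// mulr_ge0//; case/andP: (u01 j) => //.
    have UE : vle (U i w) vv = [forall j, U i w ord0 j <= v j].
      by apply: eq_forallb => j; rewrite mxE.
    rewrite hatE UE.
    have [/existsP[j nj]|nex] := boolP [exists j, (rnk X a.+1 b i j w <=
      Num.truncn (m%:R * u ord0 j))%N != (U i w ord0 j <= v j)%R].
      apply: (@le_trans _ _ 1).
        by do 2 case: [forall _, _]; rewrite ?subrr ?subr0 ?sub0r ?normrN ?normr1 ?normr0.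
      rewrite (bigD1 j)//= nj lerDl; apply: sumr_ge0 => k _; exact: ler0n.
    rewrite negb_exists in nex; move/forallP: nex => nex.
    have -> : [forall j, (rnk X a.+1 b i j w <= Num.truncn (m%:R * u ord0 j))%N] =
       [forall j, U i w ord0 j <= v j].
      by apply: eq_forallb => j; have := nex j; rewrite negbK => /eqP.
    by rewrite subrr normr0; apply: sumr_ge0 => k _; exact: ler0n.
  have -> : d%:R * (2 * e * q) = \sum_(j < d) 2 * e * q by rewrite sumr_const card_ord mulr_natl.
  rewrite exchange_big /=.
  apply: ler_sum => j _; case: (Hv j) => _ h _; apply: le_trans h.
  by rewrite natr_count.
have Dvu := D_vu vv u vv01 u01 (fun k => lexx _).
have sumt : `|\sum_(j < d) (q^-1 * (Cdot j (ww j) * y j) + Cdot j u * D (upj u j))|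
    <= d%:R * (13 * e).
  apply: le_trans (ler_norm_sum _ _ _) _.
  have -> : d%:R * (13 * e) = \sum_(j < d) 13 * e by rewrite sumr_const card_ord mulr_natl.
  by apply: ler_sum => j _; exact: term.
set S := \sum_(_ <= i < _) _.
have SE : S = \sum_(a.+1 <= i < b.+1) (vle (Uhat X a.+1 b i w) u)%:R - m%:R * C u.
  by rewrite /S sumrB sumr_const_nat subSS mulr_natl.
(* Centering the count at [C vv] instead of [C u] leaves the drift [m (C vv - C u)], which the mean
   value expansion turns into the sum of the [Cdot j (ww j) * y j]. *)
have E : q^-1 * S - (D u - \sum_(j < d) Cdot j u * D (upj u j)) =
   q^-1 * (\sum_(a.+1 <= i < b.+1) (vle (Uhat X a.+1 b i w) u)%:R - cnt a b w vv)
   + (D vv - D u) +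
   \sum_(j < d) (q^-1 * (Cdot j (ww j) * y j) + Cdot j u * D (upj u j)).
  rewrite big_split /= -mulr_sumr SE.
  have -> : \sum_(j < d) Cdot j (ww j) * y j = m%:R * (C vv - C u).
    by rewrite Cww mulr_sumr; apply: eq_bigr => j _; rewrite /y mxE; ring.
  have : D vv = q^-1 * (cnt a b w vv - m%:R * C vv) by rewrite -D_cnt mulKf// gt_eqF.
  by move=> ->; ring.
have hat' : `|q^-1 * (\sum_(a.+1 <= i < b.+1) (vle (Uhat X a.+1 b i w) u)%:R - cnt a b w vv)|
   <= d%:R * (2 * e).
  by rewrite normrM gtr0_norm ?invr_gt0// mulrC ler_pdivrMr// -mulrA.
by rewrite E; move: hat' Dvu sumt; rewrite !ler_norml; lra.
Qed.

End Grid.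

Hypothesis Cdot_ucont : forall j (eps kappa : R), 0 < eps -> 0 < kappa ->
  exists rho : R, 0 < rho /\ forall u u', unit_cube u -> unit_cube u' ->
  eps <= u ord0 j <= 1 - eps -> (forall k, `|u ord0 k - u' ord0 k| < rho) ->
  `|Cdot j u - Cdot j u'| <= kappa.

Lemma tame_approx (e delta : R) : 0 < e -> 0 < delta -> exists N : nat,
  forall n w, (N <= n)%N -> tame delta e (Btilde U C n w) ->
  forall p, D2 p ->
    `|Cn X C n w p - Cmap Cdot (Btilde U C n w) p| <= (15 * d%:R + 2) * e.
Proof.
move=> e0 delta0.
pose M := e * (Num.truncn (2 / delta)).+2%:R.
have M0 : 0 <= M by rewrite mulr_ge0// ltW.
have [M1 M3] : 0 < 2 * M + 1 /\ 0 < 2 * M + 3 * e by move: M0 e0; lra.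
(* This tolerance multiplied by [2 * M] is at most [e]; the added 1 covers the case [M = 0]. *)
have kap0 : 0 < e / (2 * M + 1) by rewrite divr_gt0.
have [rh Hrh] := choice (fun j => @Cdot_ucont j _ _ delta0 kap0).
pose rho := \big[Order.min/delta]_(j < d) rh j.
have rho0 : 0 < rho by apply: lt_bigmin => // j _; case: (Hrh j).
have rhod : rho <= delta by apply: bigmin_le_id.
(* Once [sqrt n] exceeds [K], both largeness conditions of the grid estimate hold: one per summand
   of [K]. *)
pose K := e^-1 + (2 * M + 3 * e) / (delta * rho).
have K0 : 0 < K.
  by rewrite addr_gt0 ?invr_gt0// divr_gt0// mulr_gt0.
exists (Num.truncn (K ^+ 2)).+1 => n w Nn tm [[s t] u] [/= s0 [st [t1 u01]]].
have n0 : (0 < n)%N by apply: leq_trans Nn.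
have nR : 0 < n%:R :> R by rewrite ltr0n.
have Kq : K < Num.sqrt n%:R.
  rewrite -(ger0_norm (ltW K0)) -sqrtr_sqr ltr_sqrt//.
  by apply: lt_le_trans (truncnS_gt _) _; rewrite ler_nat.
have x2 : 0 < (2 * M + 3 * e) / (delta * rho).
  by rewrite divr_gt0// mulr_gt0.
have x1 : 0 < e^-1 by rewrite invr_gt0.
have q1 : 1 <= e * Num.sqrt n%:R.
  rewrite -ler_pdivrMl// mulr1; apply: ltW; apply: lt_trans Kq; rewrite /K; lra.
have q2 : 2 * M + 3 * e < delta * Num.sqrt n%:R * rho.
  rewrite mulrAC [ltRHS]mulrC -ltr_pdivrMr ?mulr_gt0//.
  by apply: lt_trans Kq; rewrite /K; lra.
have ab : (fl n s <= fl n t)%N by apply: le_truncn; rewrite ler_wpM2l.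
have bn : (fl n t <= n)%N.
  by rewrite -[leqRHS](natrK (R := R)); apply: le_truncn; apply: ler_piMr.
have BM p : D1 p -> `|Btilde U C n w p| <= M.
  by apply: tame_bounded => //; exact: ltW.
have crho j u1 u2 : unit_cube u1 -> unit_cube u2 ->
  delta <= u1 ord0 j <= 1 - delta -> (forall k, `|u1 ord0 k - u2 ord0 k| < rho) ->
  `|Cdot j u1 - Cdot j u2| * (2 * M) <= e.
  move=> u11 u21 uj cl.
  have h : `|Cdot j u1 - Cdot j u2| <= e / (2 * M + 1).
    apply: (proj2 (Hrh j)) => // k; apply: lt_le_trans (cl k) _.
    exact: bigmin_le_cond.
  apply: (@le_trans _ _ (e / (2 * M + 1) * (2 * M + 1))); last first.
    by rewrite divfK// gt_eqF.
  by apply: ler_pM => //; [exact: mulr_ge0|rewrite lerDl].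
have := @grid_estimate n (fl n s) (fl n t) w delta e M rho n0 ab bn delta0 e0 tm BM q1
  rho0 rhod q2 crho u u01.
(* The process is a step function of time, so arbitrary times reduce to grid times. *)
have grid v r : Btilde U C n w ((fl n r)%:R / n%:R, v) = Btilde U C n w (r, v).
  rewrite /Btilde /= (_ : fl n ((fl n r)%:R / n%:R : R) = fl n r)//.
  by rewrite {1}/fl mulrC divfK ?gt_eqF// natrK.
rewrite /= !grid (eq_bigr (fun j => Cdot j u * (Btilde U C n w (t, upj u j) -
  Btilde U C n w (s, upj u j)))) // => j _.
by rewrite !grid.
Qed.

End Deterministic.

(** * Outer expectations *)

Section OuterExpectation.
Variables (R : realType) (dT : measure_display) (T : measurableType dT).
Variable P : probability T R.
Implicit Types (Y U V : T -> R) (A B : set T).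

Definition bounded_fct Y := exists M : R, forall w, `|Y w| <= M.

(** Outer expectations of bounded functions are finite, so [fine] loses nothing on them and real
    arithmetic becomes available. *)
Definition real_outer_expect Y : R := fine (outer_expect P Y).

Local Notation oe := real_outer_expect.
Local Notation EE U := (\int[P]_w (U w)%:E)%E.

Lemma bounded_fctD Y V : bounded_fct Y -> bounded_fct V -> bounded_fct (fun w => Y w + V w).
Proof.
move=> [M hM] [N hN]; exists (M + N) => w.
by apply: le_trans (ler_normD _ _) _; apply: lerD.
Qed.

Lemma bounded_fctN Y : bounded_fct Y -> bounded_fct (fun w => - Y w).
Proof. by move=> [M hM]; exists M => w; rewrite normrN. Qed.

Lemma bounded_fct_cst (c : R) : bounded_fct (fun=> c).
Proof. by exists `|c|. Qed.

Lemma bounded_fct_indic (c : R) A : bounded_fct (fun w => c * \1_A w).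
Proof.
exists `|c| => w; rewrite normrM -[leRHS]mulr1 ler_wpM2l//.
by rewrite indicE; case: (_ \in _); rewrite ?normr1 ?normr0.
Qed.

Lemma integrable_bounded_fct U : measurable_fun setT U -> bounded_fct U ->
  P.-integrable setT (EFin \o U).
Proof.
move=> mU [M hM]; apply: measurable_bounded_integrable => //.
  by apply: (@le_lt_trans _ _ 1%E); [exact: probability_le1|exact: ltry].
exists M; split; first exact: num_real.
by move=> x Mx w _ /=; apply: le_trans (hM w) _; exact: ltW.
Qed.

(** No integrability is assumed, because the majorants in [outer_expect] are arbitrary measurable
    functions; positive and negative parts are compared separately. *)
Lemma integral_le_real U V : measurable_fun setT U -> measurable_fun setT V ->
  (forall w, U w <= V w) -> (EE U <= EE V)%E.
Proof.
move=> mU mV UV; rewrite integralE [leRHS]integralE; apply: leeB.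
  apply: ge0_le_integral => //.
  - exact/measurable_funepos/measurable_EFinP.
  - exact/measurable_funepos/measurable_EFinP.
  - by move=> x _; apply: (@funepos_le _ _ setT) => //; rewrite ?inE// => y _; rewrite lee_fin.
apply: ge0_le_integral => //.
- exact/measurable_funeneg/measurable_EFinP.
- exact/measurable_funeneg/measurable_EFinP.
- by move=> x _; apply: (@funeneg_le _ _ setT) => //; rewrite ?inE// => y _; rewrite lee_fin.
Qed.

Lemma outer_expect_le Y U : measurable_fun setT U -> (forall w, Y w <= U w) ->
  (outer_expect P Y <= EE U)%E.
Proof. by move=> mU YU; apply: ereal_inf_lbound; exists U. Qed.

Lemma integral_cst_real (c : R) : EE (fun=> c) = c%:E.
Proof.
rewrite (integral_cst P measurableT c%:E) [X in (_ * X)%E](_ : _ = 1%E) ?mule1//.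
exact: probability_setT.
Qed.

Lemma outer_expect_fin Y : bounded_fct Y -> outer_expect P Y \is a fin_num.
Proof.
move=> [M hM]; rewrite fin_numE; apply/andP; split.
  rewrite gt_eqF// (lt_le_trans (ltNyr (- M)))//.
  apply: le_ereal_inf_tmp => _ [U [mU YU] <-]; rewrite -(integral_cst_real (- M)).
  apply: integral_le_real => // w; apply: le_trans (YU w).
  by have := hM w; rewrite ler_norml => /andP[].
rewrite lt_eqF// (@le_lt_trans _ _ M%:E) ?ltry// -(integral_cst_real M).
by apply: outer_expect_le => // w; apply: le_trans (ler_norm _) (hM w).
Qed.

Lemma real_outer_expectE Y : bounded_fct Y -> outer_expect P Y = (oe Y)%:E.
Proof. by move=> /outer_expect_fin h; rewrite /oe fineK. Qed.

Lemma integral_fin U : measurable_fun setT U -> bounded_fct U -> EE U \is a fin_num.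
Proof. by move=> mU bU; apply: integrable_fin_num => //; exact: integrable_bounded_fct. Qed.

Lemma real_outer_expect_le Y U (c : R) : bounded_fct Y -> measurable_fun setT U ->
  (forall w, Y w <= U w) -> (EE U <= c%:E)%E -> oe Y <= c.
Proof.
move=> bY mU YU Uc; rewrite -lee_fin -real_outer_expectE//.
exact: le_trans (outer_expect_le mU YU) Uc.
Qed.

(** A near-optimal majorant cut off at a bound of [|Y|] is still a majorant, and is bounded, hence
    integrable. *)
Lemma real_outer_expect_adherent Y (eps : R) : bounded_fct Y -> 0 < eps ->
  exists U, [/\ measurable_fun setT U, bounded_fct U, forall w, Y w <= U w &
    (EE U <= (oe Y + eps)%:E)%E].
Proof.
move=> bY eps0; have [M hM] := bY.
have /= [_ [U [mU YU] <-] hU] := lb_ereal_inf_adherent eps0 (outer_expect_fin bY).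
exists (fun w => Num.min (U w) M); split.
- exact: measurable_minr.
- exists M => w; rewrite ler_norml ge_min lexx orbT andbT le_min; apply/andP; split.
    by apply: le_trans (YU w); have := hM w; rewrite ler_norml => /andP[].
  by have := le_trans (normr_ge0 _) (hM w); lra.
- by move=> w; rewrite le_min YU (le_trans (ler_norm _) (hM w)).
- rewrite EFinD -real_outer_expectE//; apply: le_trans (ltW hU).
  apply: integral_le_real => //; first exact: measurable_minr.
  by move=> w; rewrite ge_min lexx.
Qed.

Lemma real_outer_expectD_le Y Y1 Y2 : bounded_fct Y -> bounded_fct Y1 -> bounded_fct Y2 ->
  (forall w, Y w <= Y1 w + Y2 w) -> oe Y <= oe Y1 + oe Y2.
Proof.
move=> bY bY1 bY2 h; apply/ler_addgt0Pr => eps eps0.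
have e2 : 0 < eps / 2 by rewrite divr_gt0.
have [U1 [mU1 bU1 YU1 h1]] := real_outer_expect_adherent bY1 e2.
have [U2 [mU2 bU2 YU2 h2]] := real_outer_expect_adherent bY2 e2.
apply: (@real_outer_expect_le _ (fun w => U1 w + U2 w)) => //.
- exact: measurable_funD.
- by move=> w; apply: le_trans (h w) _; apply: lerD.
- rewrite [leLHS](_ : _ = EE U1 + EE U2)%E.
    by apply: le_trans (leeD h1 h2) _; rewrite -EFinD lee_fin; lra.
  under eq_integral do rewrite EFinD.
  by apply: integralD => //; exact: integrable_bounded_fct.
Qed.

Lemma real_outer_expect_cst (c : R) : oe (fun=> c) = c.
Proof.
have bc := bounded_fct_cst c; apply/eqP; rewrite eq_le; apply/andP; split.
  by apply: (@real_outer_expect_le _ (fun=> c)) => //; rewrite integral_cst_real.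
rewrite -lee_fin -real_outer_expectE//; apply: le_ereal_inf_tmp => _ [U [mU YU] <-].
by rewrite -(integral_cst_real c); exact: integral_le_real.
Qed.

Lemma outer_prob_le A B : A `<=` B -> (outer_prob P A <= outer_prob P B)%E.
Proof.
move=> AB; apply: le_ereal_inf => _ [D [mD BD] <-].
by exists D => //; split => //; exact: subset_trans AB BD.
Qed.

Lemma outer_prob_le_measure A : measurable A -> (outer_prob P A <= P A)%E.
Proof. by move=> mA; apply: ereal_inf_lbound; exists A => //; split => // w. Qed.

Lemma outer_prob_ge0 A : (0 <= outer_prob P A)%E.
Proof. by apply: le_ereal_inf_tmp => _ [D [mD BD] <-]. Qed.

Lemma real_outer_expect_indic_le A (c p : R) : 0 <= c ->
  (outer_prob P A <= p%:E)%E -> oe (fun w => c * \1_A w) <= c * p.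
Proof.
move=> c0 Ap; apply/ler_addgt0Pr => eps eps0.
have ec : 0 < eps / (c + 1) by rewrite divr_gt0// ltr_wpDl.
have Ap' : (outer_prob P A < (p + eps / (c + 1))%:E)%E.
  by apply: le_lt_trans Ap _; rewrite lte_fin ltrDl.
have [_ [B [mB AB] <-] PB] := ereal_inf_lt Ap'.
apply: (@real_outer_expect_le _ (fun w => c * \1_B w)).
- exact: bounded_fct_indic.
- by apply: measurable_funM => //; exact: measurable_indic.
- move=> w; apply: ler_wpM2l => //; rewrite !indicE ler_nat.
  case: (boolP (w \in A)) => // wA.
  by have -> : w \in B by apply/mem_set/AB/set_mem.
- under eq_integral do rewrite EFinM.
  rewrite integralZl//; last exact: integrable_indic.
  rewrite integral_indic// setIT.
  apply: le_trans (lee_wpmul2l _ (ltW PB)) _; first by rewrite lee_fin.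
  rewrite -EFinM lee_fin mulrDr lerD2l mulrCA ler_piMr//; first exact: ltW.
  by rewrite ler_pdivrMr ?ltr_wpDl// mul1r lerDl.
Qed.

Lemma real_outer_expect_measurableN V : measurable_fun setT V -> bounded_fct V ->
  oe V + oe (fun w => - V w) <= 0.
Proof.
move=> mV bV; have fV := integral_fin mV bV.
have h1 : oe V <= fine (EE V).
  by apply: (@real_outer_expect_le _ V) => //; rewrite fineK.
have h2 : oe (fun w => - V w) <= - fine (EE V).
  apply: (@real_outer_expect_le _ (fun w => - V w)) => //.
  - exact: bounded_fctN.
  - exact: measurable_funN.
  - rewrite EFinN fineK//; under eq_integral do rewrite EFinN.
    rewrite integralN//; apply: integrable_add_def => //; exact: integrable_bounded_fct.
lra.
Qed.

Lemma outer_prob_markov Y (e p : R) : bounded_fct Y -> (forall w, 0 <= Y w) -> 0 < e ->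
  oe Y < e * p -> (outer_prob P [set w | (e < Y w)%R] <= p%:E)%E.
Proof.
move=> bY Y0 e0 hY; have eps0 : 0 < e * p - oe Y by rewrite subr_gt0.
have [U [mU bU YU hU]] := real_outer_expect_adherent bY eps0.
have mA : measurable [set w | (e < U w)%R].
  have := mU measurableT _ (measurable_itv `]e, +oo[); rewrite setTI.
  by congr (measurable _); apply/seteqP; split => w /=; rewrite in_itv/= andbT.
apply: (@le_trans _ _ (P [set w | (e < U w)%R])).
  apply: le_trans (outer_prob_le_measure mA); apply: outer_prob_le => w /= h.
  exact: lt_le_trans h (YU w).
rewrite -(@lee_pmul2l _ e%:E)// -EFinM.
apply: (@le_trans _ _ (EE U)); last first.
  by apply: le_trans hU _; rewrite lee_fin; lra.
have -> : P [set w | (e < U w)%R] = EE \1_[set w | (e < U w)%R].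
  by rewrite integral_indic// setIT.
rewrite -integralZl//; last exact: integrable_indic.
under eq_integral do rewrite -EFinM.
apply: integral_le_real => //.
  by apply: measurable_funM => //; exact: measurable_indic.
move=> w; rewrite indicE; case: (boolP (w \in _)) => [/set_mem /= /ltW|_].
  by rewrite mulr1.
by rewrite mulr0; exact: le_trans (Y0 w) (YU w).
Qed.

End OuterExpectation.

(* Measurability off [N] cannot be dropped: outer expectations are not continuous along
   decreasing sequences. *)
Lemma real_outer_expect_antitone (R : realType) (dT : measure_display)
    (T : measurableType dT) (P : probability T R) (N : set T) (M e : R)
    (Yk : nat -> T -> R) (Y : T -> R) :
  measurable N -> P N = 0%E ->
  (forall k w, `|Yk k w| <= M) -> (forall w, `|Y w| <= M) ->
  (forall k, measurable_fun (~` N) (Yk k)) -> measurable_fun (~` N) Y ->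
  (forall k k' w, (k <= k')%N -> Yk k' w <= Yk k w) ->
  (forall w (e' : R), ~ N w -> 0 < e' -> exists k, Yk k w <= Y w + e') ->
  0 < e -> exists k, real_outer_expect P (Yk k) <= real_outer_expect P Y + e.
Proof.
move=> mN N0 YkM YM mYk mY anti cvgY e0; have e2 : 0 < e / 2 by rewrite divr_gt0.
pose M' := `|M|; have M0 : 0 <= M' by exact: normr_ge0.
have MM' : M <= M' by exact: ler_norm.
(* These sets decrease to the empty set, so their probabilities tend to 0. Outside [A k] and [N] the
   excess of [Yk k] over [Y] is at most [e / 2]; elsewhere it is at most [2 * M']. *)
pose A k := (~` N) `&` [set w | Y w + e / 2 < Yk k w].
have mA k : measurable (A k).
  apply: (measurable_fun_ltr _ (mYk k) (measurableC mN) (Y := [set true])) => //.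
  exact: measurable_funD.
have A0 : \bigcap_k A k = set0.
  rewrite -subset0 => w Aw; have [Nw _] := Aw 0%N I.
  have [k hk] := cvgY w _ Nw e2.
  by have [_ /=] := Aw k I; rewrite ltNge hk.
have Aant : {homo A : n m / (n <= m)%N >-> (m <= n)%O}.
  move=> k k' kk'; apply/subsetPset => w [Nw /= h1]; split => //=.
  exact: lt_le_trans h1 (anti _ _ _ kk').
have := @nonincreasing_cvg_mu _ _ _ P A.
rewrite A0 measure0.
have p0 : 0 < e / 2 / (2 * M' + 1) by rewrite divr_gt0// ltr_wpDl// mulr_ge0.
have Afin : (P (A 0%N) < +oo)%E.
  by apply: (@le_lt_trans _ _ 1%E); [exact: probability_le1|exact: ltry].
move=> /(_ Afin mA measurable0 Aant).
move=> /(_ [set x | (x < (e / 2 / (2 * M' + 1))%:E)%E]) [|k _ Hk].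
  by apply: open_nbhs_nbhs; split; [exact: open_ereal_lt_ereal|rewrite /= lte_fin].
have {}Hk : (P (A k) < (e / 2 / (2 * M' + 1))%:E)%E by apply: Hk => /=.
exists k.
have M2 : 0 <= 2 * M' by rewrite mulr_ge0.
have PA : (outer_prob P (A k `|` N) <= (e / 2 / (2 * M' + 1))%:E)%E.
  apply: le_trans (outer_prob_le_measure _ _) _; first exact: measurableU.
  apply: le_trans (measureU2 _ (mA k) mN) _.
  have N0' : (P N <= 0)%E by rewrite N0.
  by apply: le_trans (leeD (ltW Hk) N0') _; rewrite adde0.
have h1 := real_outer_expect_indic_le M2 PA.
have h2 : 2 * M' * (e / 2 / (2 * M' + 1)) <= e / 2.
  rewrite mulrCA ler_piMr//; first exact: ltW.
  by rewrite ler_pdivrMr ?ltr_wpDl// mul1r lerDl.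
have bc := @bounded_fct_cst _ _ T (e / 2).
have bi := bounded_fct_indic (2 * M') (A k `|` N).
have h5 : real_outer_expect P (Yk k) <= real_outer_expect P Y +
    real_outer_expect P (fun w => e / 2 + 2 * M' * \1_(A k `|` N) w).
  apply: real_outer_expectD_le => //.
  - by exists M.
  - by exists M.
  - exact: bounded_fctD.
  - move=> w; rewrite indicE; have [_|nin] := boolP (w \in _).
      by have := YkM k w; have := YM w; rewrite mulr1 !ler_norml; lra.
    rewrite mulr0 addr0 leNgt; apply/negP => hw; move/negP: nin; apply; rewrite inE.
    by have [Nw|Nw] := pselect (N w); [right|left].
have h6 := real_outer_expectD_le P (bounded_fctD bc bi) bc bi (fun w => lexx _).
have h7 := real_outer_expect_cst P (e / 2).
lra.
Qed.

(** * Continuous mapping and Slutsky *)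

Lemma bounded_fct_BC (R : realType) (I T : Type) (D : set I) (h : (I -> R) -> R)
  (X : T -> I -> R) : BC_linfty D h -> exists M : R, forall w, `|h (X w)| <= M.
Proof. by move=> [[M hM] _]; exists M. Qed.

Lemma sup_cvg_prob0_le (R : realType) (I : Type) (D : set I) (dT : measure_display)
  (T : measurableType dT) (P : probability T R) (Z : nat -> T -> I -> R) (e p : R) :
  sup_cvg_prob0 D P Z -> 0 < e -> 0 < p -> exists N, forall n, (N <= n)%N ->
  (outer_prob P [set w | exists t, D t /\ (e < `|Z n w t|)%R] <= p%:E)%E.
Proof.
move=> hZ e0 p0; have := hZ e e0.
move=> /(_ [set x | (x < p%:E)%E]) [|N _ HN].
  by apply: open_nbhs_nbhs; split; [exact: open_ereal_lt_ereal|rewrite /= lte_fin].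
by exists N => n Nn; apply: ltW; exact: HN.
Qed.

Lemma weak_conv_le (R : realType) (I : Type) (D : set I) (dT : measure_display)
  (T : measurableType dT) (P : probability T R) (Xn : nat -> T -> I -> R)
  (dT' : measure_display) (T' : measurableType dT') (P' : probability T' R)
  (X : T' -> I -> R) (h : (I -> R) -> R) (e : R) :
  weak_conv_linfty D P Xn P' X -> BC_linfty D h -> 0 < e ->
  exists N, forall n, (N <= n)%N ->
  real_outer_expect P (fun w => h (Xn n w)) <= real_outer_expect P' (fun w => h (X w)) + e.
Proof.
move=> hX bh e0; have := hX h bh.
rewrite (real_outer_expectE _ (bounded_fct_BC X bh)) => /fine_cvg /cvgrPdist_le /(_ e e0)[N _ HN].
exists N => n /HN /=; rewrite -/(real_outer_expect P (fun w => h (Xn n w))) ler_norml.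
lra.
Qed.

Section Slutsky.
Variables (R : realType) (I J : Type) (D : set I) (E : set J).
Variables (Phi : (I -> R) -> J -> R) (l : R).
Variables (dT : measure_display) (T : measurableType dT) (P : probability T R).
Variables (dT' : measure_display) (T' : measurableType dT') (P' : probability T' R).
Variables (Xn : nat -> T -> I -> R) (Yn : nat -> T -> J -> R) (X : T' -> I -> R).
Variable N : set T'.
Hypothesis l0 : 0 <= l.
Hypothesis Phi_lip : forall f g (c : R), 0 <= c -> (forall t, D t -> `|f t - g t| <= c) ->
  forall t, E t -> `|Phi f t - Phi g t| <= l * c.
Hypothesis Phi_bounded : forall f, bounded_on D f -> bounded_on E (Phi f).
Hypothesis Yn_bounded : forall n w, bounded_on E (Yn n w).
Hypotheses (mN : measurable N) (N0 : P' N = 0%E).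
Hypothesis X_bounded : forall w, ~ N w -> bounded_on D (X w).
Hypothesis X_measurable : forall H, BC_linfty D H ->
  measurable_fun (~` N) (fun w => H (X w)).
Hypothesis Xn_X : weak_conv_linfty D P Xn P' X.
Hypothesis Yn_Xn : sup_cvg_prob0 E P (fun n w t => Yn n w t - Phi (Xn n w) t).

Lemma BC_linfty_comp h : BC_linfty E h -> BC_linfty D (fun f => h (Phi f)).
Proof.
move=> [[M hM] hc]; split; first by exists M.
move=> f bf e e0; have [delta [d0 Hd]] := hc _ (Phi_bounded bf) e e0.
have l1 : 0 < l + 1 by rewrite ltr_wpDl.
exists (delta / (l + 1)); split; first exact: divr_gt0.
move=> g bg [eta [eta_d fg]]; apply: Hd; first exact: Phi_bounded.
(* When [D] is empty, [supdist_lt] allows a negative [eta]. *)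
have c0 : 0 <= Num.max eta 0 by rewrite le_max lexx orbT.
exists (l * Num.max eta 0); split.
  have : Num.max eta 0 < delta / (l + 1) by rewrite gt_max eta_d divr_gt0.
  rewrite ltr_pdivlMr// => h1; apply: le_lt_trans h1; rewrite mulrC ler_wpM2l//.
  by rewrite lerDl.
by apply: Phi_lip => // t Dt; apply: le_trans (fg t Dt) _; rewrite le_max lexx.
Qed.

Section Regularization.
Variables (h : (J -> R) -> R) (M : R).
Hypotheses (bh : BC_linfty E h) (hM : forall f, `|h f| <= M).

Let hM1 f : h f <= M. Proof. exact: le_trans (ler_norm _) (hM f). Qed.
Let hM2 f : - M <= h f. Proof. by have := hM f; rewrite ler_norml => /andP[]. Qed.

(* The element [- M] keeps the set nonempty, hence its [sup] meaningful, when [Phi f] is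
   unbounded. *)
Definition reg_set (k : nat) (f : I -> R) : set R :=
  [set x | x = - M \/ exists g c, [/\ 0 <= c, bounded_on E g,
     forall t, E t -> `|g t - Phi f t| <= c & x = h g - k%:R * c]].

(** The upper Lipschitz envelope (sup-convolution) of [h] with penalty [k] times the uniform
    distance, evaluated at [Phi f]. *)
Definition reg k f := sup (reg_set k f).

Let reg_ub k f x : reg_set k f x -> x <= M.
Proof.
move=> [->|[g [c [c0 _ _ ->]]]].
  exact: le_trans (hM2 (fun=> 0)) (hM1 _).
by apply: le_trans (hM1 g); rewrite gerBl mulr_ge0.
Qed.

Let reg_has_sup k f : has_sup (reg_set k f).
Proof.
split; first by exists (- M); left.
by exists M => x; exact: reg_ub.
Qed.

Let reg_ge k f x : reg_set k f x -> x <= reg k f.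
Proof. by move=> h1; apply: ub_le_sup => //; case: (reg_has_sup k f). Qed.

Let reg_le k f x : (forall y, reg_set k f y -> y <= x) -> reg k f <= x.
Proof. by move=> h1; apply: ge_sup => //; case: (reg_has_sup k f). Qed.

Let reg_norm k f : `|reg k f| <= M.
Proof.
rewrite ler_norml; apply/andP; split; first by apply: reg_ge; left.
by apply: reg_le => y; exact: reg_ub.
Qed.

Let reg_major k f g c : 0 <= c -> bounded_on E g ->
  (forall t, E t -> `|g t - Phi f t| <= c) -> h g <= reg k f + k%:R * c.
Proof. by move=> c0 bg gf; rewrite -lerBlDr; apply: reg_ge; right; exists g, c. Qed.

Let reg_antitone f k k' : (k <= k')%N -> reg k' f <= reg k f.
Proof.
move=> kk'; apply: reg_le => y [->|[g [c [c0 bg gf ->]]]]; first by apply: reg_ge; left.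
apply: le_trans (_ : h g - k%:R * c <= _); last by apply: reg_ge; right; exists g, c.
by rewrite lerD2l lerN2 ler_wpM2r// ler_nat.
Qed.

Let reg_lip k f g c : 0 <= c -> (forall t, D t -> `|f t - g t| <= c) ->
  reg k f <= reg k g + k%:R * (l * c).
Proof.
move=> c0 fg; apply: reg_le => y [->|[g' [c' [c'0 bg' gf' ->]]]].
  rewrite -[leLHS]addr0; apply: lerD; first by apply: reg_ge; left.
  by rewrite !mulr_ge0.
rewrite lerBlDr -addrA -mulrDr; apply: reg_major => //.
  by rewrite addr_ge0// mulr_ge0.
move=> t Et; have := gf' t Et; have := Phi_lip c0 fg Et.
by rewrite !ler_norml; lra.
Qed.

Let reg_BC k : BC_linfty D (reg k).
Proof.
split; first by exists M => f; exact: reg_norm.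
move=> f bf e e0; have kl : 0 < k%:R * l + 1 by rewrite ltr_wpDl// mulr_ge0.
exists (e / (k%:R * l + 1)); split; first exact: divr_gt0.
move=> g bg [eta [eta_d fg]].
have c0 : 0 <= Num.max eta 0 by rewrite le_max lexx orbT.
have ce : k%:R * (l * Num.max eta 0) < e.
  have : Num.max eta 0 < e / (k%:R * l + 1) by rewrite gt_max eta_d divr_gt0.
  rewrite ltr_pdivlMr// => h1; apply: le_lt_trans h1.
  rewrite [leRHS](_ : _ = k%:R * (l * Num.max eta 0) + Num.max eta 0); last by ring.
  by rewrite lerDl.
have fg1 t : D t -> `|f t - g t| <= Num.max eta 0.
  by move=> Dt; apply: le_trans (fg t Dt) _; rewrite le_max lexx.
have fg2 t : D t -> `|g t - f t| <= Num.max eta 0 by rewrite distrC; exact: fg1.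
have := reg_lip k c0 fg1; have := reg_lip k c0 fg2.
by rewrite ltr_norml; lra.
Qed.

(** Competitors [g] within [delta] of [Phi f] are controlled by continuity of [h] at [Phi f]; for
    the others the penalty exceeds [2 * M], the largest possible gain. *)
Let reg_cvg f (e : R) : bounded_on D f -> 0 < e ->
  exists k, reg k f <= h (Phi f) + e.
Proof.
move=> bf e0; have [delta [d0 Hd]] := proj2 bh _ (Phi_bounded bf) e e0.
exists (Num.truncn (2 * M / delta)).+1.
apply: reg_le => y [->|[g [c [c0 bg gf ->]]]].
  by apply: le_trans (hM2 (Phi f)) _; rewrite lerDl ltW.
have [cd|dc] := ltP c delta.
  have : `|h (Phi f) - h g| < e.
    by apply: Hd => //; exists c; split => // t Et; rewrite distrC; exact: gf.
  have kc : 0 <= (Num.truncn (2 * M / delta)).+1%:R * c by rewrite mulr_ge0.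
  by rewrite ltr_norml; lra.
have := truncnS_gt (2 * M / delta); rewrite ltr_pdivrMr// => h1.
have h2 : (Num.truncn (2 * M / delta)).+1%:R * delta <=
  (Num.truncn (2 * M / delta)).+1%:R * c by rewrite ler_wpM2l.
have := hM1 g; have := hM2 (Phi f); lra.
Qed.

Let reg_oe (e : R) : 0 < e -> exists k,
  real_outer_expect P' (fun w => reg k (X w)) <=
  real_outer_expect P' (fun w => h (Phi (X w))) + e.
Proof.
move=> e0; apply: (real_outer_expect_antitone (M := M) mN N0) => //.
- by move=> k; exact: (X_measurable (reg_BC k)).
- exact: (X_measurable (BC_linfty_comp bh)).
- by move=> k k' w; exact: reg_antitone.
- by move=> w e' Nw; apply: reg_cvg; exact: X_bounded.
Qed.

(** Continuity of [h] is not uniform, so closeness of [Yn] and [Phi Xn] cannot be used on [h]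
    directly; the envelope supplies a uniform modulus. The four quarters of [e] pay for the
    envelope, the weak convergence, the penalty on the good event, and [2 * M] times the probability
    of the bad event. *)
Lemma slutsky_le (e : R) : 0 < e -> exists n0, forall n, (n0 <= n)%N ->
  real_outer_expect P (fun w => h (Yn n w)) <=
  real_outer_expect P' (fun w => h (Phi (X w))) + e.
Proof.
move=> e0; have M0 : 0 <= M by apply: le_trans (hM (fun=> 0)).
have e4 : 0 < e / 4 by rewrite divr_gt0.
have [k hk] := reg_oe e4.
have [n1 H1] := weak_conv_le Xn_X (reg_BC k) e4.
have M2 : 0 <= 2 * M by rewrite mulr_ge0.
have p0 : 0 < e / 4 / (2 * M + 1) by rewrite divr_gt0// ltr_wpDl.
have c0 : 0 < e / 4 / (k%:R + 1) by rewrite divr_gt0// ltr_wpDl.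
have [n2 H2] := sup_cvg_prob0_le Yn_Xn c0 p0.
exists (maxn n1 n2) => n; rewrite geq_max => /andP[/H1 h1 /H2 h2].
set B := [set w | _] in h2.
have h3 := real_outer_expect_indic_le M2 h2.
have h4 : 2 * M * (e / 4 / (2 * M + 1)) <= e / 4.
  rewrite mulrCA ler_piMr//; first exact: ltW.
  by rewrite ler_pdivrMr ?ltr_wpDl// mul1r lerDl.
have bX : bounded_fct (fun w => reg k (Xn n w)) by exists M => w; exact: reg_norm.
have bc := @bounded_fct_cst _ _ T (e / 4).
have bi := bounded_fct_indic (2 * M) B.
have h5 : real_outer_expect P (fun w => h (Yn n w)) <= real_outer_expect P (fun w => reg k (Xn n w))
   + real_outer_expect P (fun w => e / 4 + 2 * M * \1_B w).
  apply: real_outer_expectD_le => //.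
  - by exists M.
  - exact: bounded_fctD.
  - move=> w; rewrite indicE; have [_|nin] := boolP (w \in _).
      rewrite mulr1; have := reg_norm k (Xn n w); rewrite ler_norml.
      by have := hM1 (Yn n w); lra.
    rewrite mulr0 addr0.
    have hc : 0 <= e / 4 / (k%:R + 1) by exact: ltW.
    apply: le_trans (@reg_major k (Xn n w) _ _ hc (Yn_bounded n w) _) _.
      move=> t Et; rewrite leNgt; apply/negP => ht; move/negP: nin; apply.
      by rewrite inE /B /=; exists t; split.
    rewrite lerD2l mulrCA ler_piMr//; first exact: ltW.
    by rewrite ler_pdivrMr ?ltr_wpDl// mul1r lerDl.
have h6 := real_outer_expectD_le P (bounded_fctD bc bi) bc bi (fun w => lexx _).
have h7 := real_outer_expect_cst P (e / 4).
lra.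
Qed.

End Regularization.


(** Subadditivity gives the opposite inequality for any bounded [f]; this one rests on
    measurability. The values of [f] on [N] are replaced by a constant, which changes outer
    expectations by at most [K] times those of the indicator of a null set. *)
Lemma real_outer_expect_measurable_offN (f : T' -> R) : bounded_fct f ->
  measurable_fun (~` N) f ->
  real_outer_expect P' f + real_outer_expect P' (fun w => - f w) <= 0.
Proof.
move=> bf mf; have [M hM] := bf.
pose V := f \_ (~` N).
have mV : measurable_fun setT V by apply/(measurable_restrictT _ (measurableC mN)).
pose pt : R := point.
have VN w : N w -> V w = pt by move=> Nw; rewrite /V patchE memNset//; exact.
have VNc w : ~ N w -> V w = f w by move=> Nw; rewrite /V patchE mem_set.
have bV : bounded_fct V.
  exists (`|M| + `|pt|) => w; have [Nw|Nw] := pselect (N w).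
    by rewrite VN// lerDr.
  by rewrite VNc//; apply: le_trans (hM w) _; rewrite ler_wpDr// ler_norm.
pose K := `|M| + `|pt|.
have K0 : 0 <= K by rewrite addr_ge0.
have PN : (outer_prob P' N <= 0%:E)%E.
  by apply: le_trans (outer_prob_le_measure _ mN) _; rewrite N0.
have h1 := real_outer_expect_indic_le K0 PN; rewrite mulr0 in h1.
have bi := bounded_fct_indic K N.
have ptM := ler_norm M; have pt1 := ler_norm pt; have pt2 := ler_norm (- pt).
rewrite normrN in pt2.
have h2 := real_outer_expect_measurableN P' mV bV.
have h3 : real_outer_expect P' f <= real_outer_expect P' V +
    real_outer_expect P' (fun w => K * \1_N w).
  apply: real_outer_expectD_le => // w; rewrite indicE.
  have [Nw|Nw] := pselect (N w).
    by rewrite VN// mem_set// mulr1 /K; have := hM w; rewrite ler_norml; lra.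
  by rewrite VNc// memNset// mulr0 addr0.
have h4 : real_outer_expect P' (fun w => - f w) <= real_outer_expect P' (fun w => - V w) +
    real_outer_expect P' (fun w => K * \1_N w).
  apply: real_outer_expectD_le => //; [exact: bounded_fctN|exact: bounded_fctN|].
  move=> w; rewrite indicE.
  have [Nw|Nw] := pselect (N w).
    by rewrite VN// mem_set// mulr1 /K; have := hM w; rewrite ler_norml; lra.
  by rewrite VNc// memNset// mulr0 addr0.
lra.
Qed.

(** The upper bound is applied to [h] and to [- h]. The latter becomes a lower bound for [h] because
    outer expectation is subadditive along the sequence and additive on the measurable limit
    functional. *)
Theorem slutsky : weak_conv_linfty E P Yn P' (fun w => Phi (X w)).
Proof.
move=> h bh; have [[M hM] hc] := bh.
have hM' f : `|- h f| <= M by rewrite normrN.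
have bhN : BC_linfty E (fun f => - h f).
  split; first by exists M.
  move=> f bf e e0; have [delta [d0 H]] := hc f bf e e0; exists delta; split => // g bg fg.
  by rewrite -opprD normrN; exact: H.
have bY n : bounded_fct (fun w => h (Yn n w)) by exists M.
have bX : bounded_fct (fun w => h (Phi (X w))) by exists M.
rewrite (real_outer_expectE P' bX); apply/fine_cvgP; split.
  by apply: nearW => n; exact: outer_expect_fin.
apply/cvgrPdist_le => e e0.
have [n1 H1] := slutsky_le bh hM e0.
have [n2 H2] := slutsky_le bhN hM' e0.
exists (maxn n1 n2) => // n /=; rewrite geq_max => /andP[/H1 h1 /H2 h2].
have h3 := real_outer_expect_measurable_offN bX (X_measurable (BC_linfty_comp bh)).
have h4 : real_outer_expect P (fun=> 0) <= real_outer_expect P (fun w => h (Yn n w)) +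
   real_outer_expect P (fun w => - h (Yn n w)).
  apply: real_outer_expectD_le => //; [exact: bounded_fct_cst|exact: bounded_fctN|].
  by move=> w; rewrite subrr.
rewrite real_outer_expect_cst in h4.
rewrite -/(real_outer_expect P (fun w => h (Yn n w))) ler_norml; lra.
Qed.

End Slutsky.

(** * Measurability of functionals of continuous paths *)

(** Heine's theorem through the near-covering form of compactness: if [x'] is within [r / 2] of [x]
    and [y] within [r / 2] of [x'], both lie in the ball of radius [r] on which [f] varies
    little. *)
Lemma compact_unif_continuous (R : realType) (M : pseudoMetricType R) (K : set M)
    (f : M -> R) (e : R) : compact K -> {within K, continuous f} -> 0 < e ->
  exists delta : R, 0 < delta /\
    forall x y, K x -> K y -> ball x delta y -> `|f x - f y| <= e.
Proof.
move=> cK /subspace_continuousP fK e0; have e2 : 0 < e / 2 by rewrite divr_gt0.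
have cov := (near_covering_withinP K).2 ((compact_near_coveringP K).1 cK).
have := cov R (nbhs (0 : R)^'+)
  (fun delta x => forall y, K y -> ball x delta y -> `|f x - f y| <= e) _.
case=> [x Kx|delta /= delta0 H].
  have /cvgrPdist_lt /(_ _ e2) := fK x Kx.
  rewrite /within /= => /nbhs_ballP[r /= r0 Hr].
  have r2 : 0 < r / 2 by rewrite divr_gt0.
  exists ((ball x (r / 2)), [set delta | delta < r / 2]).
    by split; [exact: nbhsx_ballx|exact: nbhs_right_lt].
  move=> [x' delta] [/= xx' dr] Kx' y Ky x'y.
  have h1 : `|f x - f x'| < e / 2.
    by apply: Hr => //; apply: le_ball xx'; move: r0; lra.
  have h2 : `|f x - f y| < e / 2.
    apply: Hr => //; rewrite (splitr r); apply: ball_triangle xx' _.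
    by apply: le_ball x'y; exact: ltW.
  by move: h1 h2; rewrite !ltr_norml ler_norml; lra.
exists (delta / 2); split; first by rewrite divr_gt0.
move=> x y Kx Ky; apply: (H (delta / 2)) => //=.
- by rewrite sub0r normrN gtr0_norm ?divr_gt0//; move: delta0; lra.
- by rewrite divr_gt0.
Qed.

Section Quantization.
Variables (R : realType) (I : Type) (D : set I).
Variables (dT : measure_display) (T : measurableType dT) (X : T -> I -> R) (N : set T).
Variables (G : nat -> finType) (pt : forall m, G m -> I) (idx : forall m, I -> G m).
Hypothesis X_measurable : forall t, D t -> measurable_fun setT (fun w => X w t).
Hypothesis X_bounded : forall w, ~ N w -> bounded_on D (X w).
Hypothesis pt_D : forall m (g : G m), D (pt g).
Hypothesis X_grid : forall w (e : R), ~ N w -> 0 < e -> exists m0, forall m t,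
  (m0 <= m)%N -> D t -> `|X w (pt (idx m t)) - X w t| <= e.

Let code m w : {ffun G m -> int} := [ffun g => Num.floor (X w (pt g) * m.+1%:R)].
Let decode m (k : {ffun G m -> int}) (t : I) : R := (k (idx m t))%:~R / m.+1%:R.

Let measurable_code m k : measurable [set w | code m w = k].
Proof.
have -> : [set w | code m w = k] = \bigcap_(g in [set: G m])
    [set w | (k g)%:~R <= X w (pt g) * m.+1%:R < (k g + 1)%:~R].
  apply/seteqP; split => [w /= <- g _ /=|w /= H].
    by rewrite /= ffunE floor_itv.
  by apply/ffunP => g; rewrite ffunE; apply/eqP; rewrite floor_eq; exact: H.
apply: fin_bigcap_measurable => [|g _]; first exact: finite_finset.
have mX : measurable_fun setT (fun w => X w (pt g) * m.+1%:R).
  by apply: measurable_funM => //; exact: X_measurable.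
have := mX measurableT _ (measurable_itv `[(k g)%:~R, (k g + 1)%:~R[).
by rewrite setTI; congr (measurable _); apply/seteqP; split => w /=; rewrite in_itv.
Qed.

(* A functional of a countably valued approximation is measurable whatever the
   functional; continuity passes to the limit. *)
Lemma measurable_BC_linfty H : BC_linfty D H ->
  measurable_fun (~` N) (fun w => H (X w)).
Proof.
move=> [[M hM] hc].
apply: (@measurable_fun_cvg _ _ _ (~` N) (fun m w => H (decode (code m w)))) => [m|w Nw].
  apply: measurable_funTS => _ Y mY; rewrite setTI.
  have -> : (fun w => H (decode (code m w))) @^-1` Y =
      \bigcup_(k : {ffun G m -> int})
      (if pselect (Y (H (decode k))) then [set w | code m w = k] else set0).
    apply/seteqP; split => [w /= Yw|w [k _]].
      by exists (code m w) => //; case: pselect.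
    by case: pselect => // Yk /= ->.
  apply: countable_bigcupT_measurable => [|k]; first exact: countableP.
  by case: pselect => ? //=; exact: measurable0.
apply/cvgrPdist_lt => e e0.
have [delta [delta0 Hd]] := hc _ (X_bounded Nw) e e0.
have d2 : 0 < delta / 4 by rewrite divr_gt0.
have [m0 Hm0] := X_grid Nw d2.
exists (maxn m0 (Num.truncn (4 / delta))) => // m /=; rewrite geq_max => /andP[mm0 md].
have m1 : 0 < m.+1%:R :> R by [].
(* Grid error [delta / 4] plus rounding error [delta / 4], leaving room for the strict inequality in
   [supdist_lt]. *)
have dec t : D t -> `|X w t - decode (code m w) t| <= delta / 2.
  move=> Dt; have := Hm0 m t mm0 Dt; rewrite /decode /code ffunE.
  set x := X w (pt _) => h1.
  have /andP[f1 f2] := floor_itv (x * m.+1%:R).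
  have h2 : `|(Num.floor (x * m.+1%:R))%:~R / m.+1%:R - x| <= delta / 4.
    have h3 : m.+1%:R^-1 <= delta / 4.
      rewrite -[delta / 4]invrK lef_pV2 ?posrE ?invr_gt0// invf_div.
      by apply: ltW; apply: lt_le_trans (truncnS_gt _) _; rewrite ler_nat.
    have h4 : (Num.floor (x * m.+1%:R))%:~R / m.+1%:R <= x by rewrite ler_pdivrMr.
    have h5 : x < (Num.floor (x * m.+1%:R))%:~R / m.+1%:R + m.+1%:R^-1.
      by rewrite -[X in _ < _ + X]mul1r -mulrDl ltr_pdivlMr//; rewrite intrD in f2.
    rewrite ler_distlC; apply/andP; split.
      by rewrite lerBlDr; apply: le_trans h4 _; rewrite lerDl ltW.
    by apply: le_trans (ltW h5) _; rewrite lerD2l.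
  move: h1 h2; move: ((Num.floor _)%:~R / _) => y; rewrite !ler_norml; lra.
apply: Hd.
  have [B hB] := X_bounded Nw; exists (B + delta / 2) => t Dt.
  by have := hB t Dt; have := dec t Dt; rewrite !ler_norml; lra.
by exists (delta / 2); split => //; move: delta0; lra.
Qed.

End Quantization.

(** * Limit paths and their truncated modulus of continuity *)

Section LimitPaths.
Variables (R : realType) (d : nat).
Implicit Types (alpha : R * 'rV[R]_d -> R).

Lemma unit_cube_compact : compact (@unit_cube R d).
Proof.
have := @rV_compact R d (fun=> `[0, 1]%classic) (fun=> @segment_compact R 0 1).
by congr (compact _); apply/seteqP; split => u /= h j; have := h j; rewrite /= in_itv.
Qed.

Lemma D1_compact : compact (@D1 R d).
Proof.
have := compact_setX (@segment_compact R 0 1) unit_cube_compact.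
by congr (compact _); apply/seteqP; split => [[s u]] /=; rewrite in_itv /=; case.
Qed.

Lemma close_pts_ball (delta : R) (p q : R * 'rV[R]_d) : close_pts delta p q -> ball p delta q.
Proof.
case=> h1 h2; split => //=; split; first exact: le_lt_trans h1.
by move=> i j; rewrite (ord1 i); exact: h2.
Qed.

Lemma boundary_cont_tame alpha (e : R) : boundary_cont_set alpha -> 0 < e ->
  exists delta : R, 0 < delta /\ tame delta e alpha.
Proof.
move=> [ca [a0 a1]] e0.
have [delta [delta0 H]] := compact_unif_continuous D1_compact ca e0.
exists delta; split => //; split => [p q Dp Dq pq|p Dp np].
  by apply: H => //; exact: close_pts_ball.
suff -> : alpha p = 0 by rewrite normr0 ltW.
case: np => [p0|p0|p1]; [by apply: a0 => //; left|by apply: a0 => //; right|].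
(* Vanishing at the all-ones vector is given only for times in [(0, 1]]; time 0 belongs to the other
   boundary condition. *)
have [p0|p0] := eqVneq p.1 0; first by apply: a0 => //; left.
have [/andP[s0 s1] _] := Dp.
by case: p p1 p0 s0 s1 {Dp} => s u /= -> p0 s0 s1; apply: a1; rewrite s1 lt_neqAle eq_sym p0 s0.
Qed.

Lemma boundary_cont_bounded alpha : boundary_cont_set alpha -> bounded_on D1 alpha.
Proof.
move=> /(boundary_cont_tame (e := 1)) /(_ ltr01)[delta [delta0 ta]].
by eexists => p; apply: tame_bounded ta => //; exact: ltW.
Qed.

Let G (m : nat) : finType := ('I_m.+2 * {ffun 'I_d -> 'I_m.+2})%type.
Let pt m (g : G m) : R * 'rV[R]_d :=
  (g.1%:R / m.+1%:R, \row_j ((g.2 j)%:R / m.+1%:R)).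
Let idx m (p : R * 'rV[R]_d) : G m :=
  (inord (Num.truncn (p.1 * m.+1%:R)), [ffun j => inord (Num.truncn (p.2 ord0 j * m.+1%:R))]).

Let pt_D1 m (g : G m) : D1 (pt g).
Proof.
have H (i : 'I_m.+2) : 0 <= (i%:R / m.+1%:R : R) <= 1.
  by rewrite divr_ge0//= ler_pdivrMr// mul1r ler_nat -ltnS.
by split => [|j] /=; rewrite ?mxE.
Qed.

Let coord_close m (x : R) : 0 <= x <= 1 ->
  `|(inord (Num.truncn (x * m.+1%:R)) : 'I_m.+2)%:R / m.+1%:R - x| <= m.+1%:R^-1.
Proof.
move=> /andP[x0 x1]; have xm : 0 <= x * m.+1%:R by rewrite mulr_ge0.
(* The index may equal [m.+1], namely at [x = 1]; with [m.+2] nodes per axis [inord] never falls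
   back to its default. *)
rewrite inordK; last first.
  rewrite ltnS -[leqRHS](natrK (R := R)); apply: le_truncn.
  by rewrite ler_piMl.
have /andP[f1 f2] := truncn_itv xm.
rewrite ler_distlC; apply/andP; split.
  rewrite lerBlDr (@le_trans _ _ x) ?lerDl ?invr_ge0//.
  by rewrite ler_pdivrMr.
rewrite -[X in _ <= _ + X]mul1r -mulrDl ler_pdivlMr// natr1; exact: ltW.
Qed.

Let grid_approx alpha (e : R) : boundary_cont_set alpha -> 0 < e ->
  exists m0, forall m p, (m0 <= m)%N -> D1 p -> `|alpha (pt (idx m p)) - alpha p| <= e.
Proof.
move=> ba e0; have [delta [delta0 [ta _]]] := boundary_cont_tame ba e0.
exists (Num.truncn delta^-1) => m p m0 Dp.
have md : m.+1%:R^-1 < delta.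
  rewrite -[delta]invrK ltf_pV2 ?posrE ?invr_gt0//.
  by apply: lt_le_trans (truncnS_gt _) _; rewrite ler_nat.
case: (Dp) => p1 p2; apply: ta => //; split => [|j] /=.
  exact: le_lt_trans (coord_close m p1) md.
by rewrite mxE ffunE; apply: le_lt_trans (coord_close m (p2 j)) md.
Qed.

Lemma BC_linfty_path_measurable (dT : measure_display) (T : measurableType dT)
    (B : T -> R * 'rV[R]_d -> R) (N : set T) H :
  measurable N -> (forall p, D1 p -> measurable_fun setT (fun w => B w p)) ->
  (forall w, ~ N w -> boundary_cont_set (B w)) ->
  BC_linfty D1 H -> measurable_fun (~` N) (fun w => H (B w)).
Proof.
move=> mN mB cB bH.
have bd w : ~ N w -> bounded_on D1 (B w) by move=> Nw; apply: boundary_cont_bounded; exact: cB.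
have gr w (e : R) : ~ N w -> 0 < e -> exists m0, forall m p,
    (m0 <= m)%N -> D1 p -> `|B w (pt (idx m p)) - B w p| <= e.
  by move=> Nw; apply: grid_approx; exact: cB.
exact: (measurable_BC_linfty mB bd pt_D1 gr bH).
Qed.

(** Truncation at 1 makes the supremum finite and bounded for every [alpha], so that it defines a
    functional in [BC_linfty]; the element 0 makes it nonnegative. *)
Definition osc_set (delta : R) alpha : set R := [set x | [\/ x = 0,
  exists p q, [/\ D1 p, D1 q, close_pts delta p q & x = Num.min 1 `|alpha p - alpha q|] |
  exists p, [/\ D1 p, null_pt p & x = Num.min 1 `|alpha p|]]].

Definition osc delta alpha := sup (osc_set delta alpha).

Let osc_set_le1 delta alpha x : osc_set delta alpha x -> x <= 1.
Proof.
by case=> [->//|[p [q [_ _ _ ->]]]|[p [_ _ ->]]]; rewrite ge_min lexx.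
Qed.

Let osc_ub delta alpha x : osc_set delta alpha x -> x <= osc delta alpha.
Proof. by move=> h; apply: ub_le_sup => //; exists 1 => y; exact: osc_set_le1. Qed.

Let osc_le delta alpha x : (forall y, osc_set delta alpha y -> y <= x) -> osc delta alpha <= x.
Proof. by move=> h; apply: ge_sup => //; exists 0; exact: Or31. Qed.

Lemma osc_ge0 delta alpha : 0 <= osc delta alpha.
Proof. by apply: osc_ub; exact: Or31. Qed.

Lemma osc_le1 delta alpha : osc delta alpha <= 1.
Proof. by apply: osc_le => y; exact: osc_set_le1. Qed.

Lemma osc_homo delta delta' alpha : delta <= delta' -> osc delta alpha <= osc delta' alpha.
Proof.
move=> dd; apply: osc_le => y hy; apply: osc_ub.
case: hy => [->|[p [q [Dp Dq [pq1 pq2] ->]]]|h]; [exact: Or31| |exact: Or33].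
apply: Or32; exists p, q; split => //; split; first exact: lt_le_trans dd.
by move=> j; exact: lt_le_trans dd.
Qed.

Lemma osc_tame delta alpha (e : R) : e < 1 -> osc delta alpha <= e -> tame delta e alpha.
Proof.
move=> e1 oe; split => [p q Dp Dq pq|p Dp np].
  have : Num.min 1 `|alpha p - alpha q| <= e.
    by apply: le_trans oe; apply: osc_ub; apply: Or32; exists p, q.
  by rewrite ge_min leNgt e1.
have : Num.min 1 `|alpha p| <= e.
  by apply: le_trans oe; apply: osc_ub; apply: Or33; exists p.
by rewrite ge_min leNgt e1.
Qed.

Lemma tame_osc delta alpha (e : R) : 0 <= e -> tame delta e alpha -> osc delta alpha <= e.
Proof.
move=> e0 [t1 t2]; apply: osc_le => y.
case=> [->//|[p [q [Dp Dq pq ->]]]|[p [Dp np ->]]]; rewrite ge_min.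
  by rewrite t1 ?orbT.
by rewrite t2 ?orbT.
Qed.

Lemma osc_lip delta alpha beta (c : R) : 0 <= c ->
  (forall p, D1 p -> `|alpha p - beta p| <= c) -> osc delta alpha <= osc delta beta + 2 * c.
Proof.
move=> c0 ab.
have minD (x y : R) : x <= y + 2 * c -> Num.min 1 x <= Num.min 1 y + 2 * c.
  by move=> xy; rewrite /Num.min; case: ifP; case: ifP; move: c0 xy; lra.
apply: osc_le => y.
case=> [->|[p [q [Dp Dq pq ->]]]|[p [Dp np ->]]].
- by rewrite addr_ge0 ?osc_ge0// mulr_ge0.
- apply: (@le_trans _ _ (Num.min 1 `|beta p - beta q| + 2 * c)).
    apply: minD; have := ab p Dp; have := ab q Dq.
    have := ler_norm (beta p - beta q); have := ler_norm (- (beta p - beta q)).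
    by rewrite normrN !ler_norml; lra.
  by rewrite lerD2r; apply: osc_ub; apply: Or32; exists p, q.
- apply: (@le_trans _ _ (Num.min 1 `|beta p| + 2 * c)).
    apply: minD; have := ab p Dp.
    have := ler_norm (beta p); have := ler_norm (- (beta p)).
    by rewrite normrN !ler_norml; lra.
  by rewrite lerD2r; apply: osc_ub; apply: Or33; exists p.
Qed.

Lemma osc_BC delta : BC_linfty D1 (osc delta).
Proof.
split; first by exists 1 => f; rewrite ger0_norm ?osc_ge0 ?osc_le1.
move=> f _ e e0; exists (e / 4); split; first by rewrite divr_gt0.
move=> g _ [eta [eta_e fg]].
have c0 : 0 <= Num.max eta 0 by rewrite le_max lexx orbT.
have ce : Num.max eta 0 < e / 4 by rewrite gt_max eta_e divr_gt0.
have fg1 p : D1 p -> `|f p - g p| <= Num.max eta 0.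
  by move=> Dp; apply: le_trans (fg p Dp) _; rewrite le_max lexx.
have fg2 p : D1 p -> `|g p - f p| <= Num.max eta 0 by rewrite distrC; exact: fg1.
have := osc_lip delta c0 fg1; have := osc_lip delta c0 fg2.
by rewrite ltr_norml; lra.
Qed.

(** Off [N] the truncated modulus of the limit path decreases to 0 with [delta], hence so does its
    outer expectation. Weak convergence carries the smallness to [Xn], and Markov's inequality turns
    it into a probability bound. *)
Lemma asymptotically_tame (dT : measure_display) (T : measurableType dT)
    (P : probability T R) (dT' : measure_display) (T' : measurableType dT')
    (P' : probability T' R) (Xn : nat -> T -> R * 'rV[R]_d -> R)
    (B : T' -> R * 'rV[R]_d -> R) (N : set T') (e p : R) :
  measurable N -> P' N = 0%E ->
  (forall p, D1 p -> measurable_fun setT (fun w => B w p)) ->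
  (forall w, ~ N w -> boundary_cont_set (B w)) ->
  weak_conv_linfty D1 P Xn P' B -> 0 < e -> 0 < p ->
  exists delta : R, 0 < delta /\ exists n0, forall n, (n0 <= n)%N ->
    (outer_prob P [set w | ~ tame delta e (Xn n w)] <= p%:E)%E.
Proof.
move=> mN N0 mB cB XB e0 p0.
(* Below the truncation level 1, where a small [osc] does imply tameness. *)
pose e' := Num.min e (1 / 2).
have e'0 : 0 < e' by rewrite lt_min e0 divr_gt0.
have e'1 : e' < 1 by rewrite gt_min orbC; apply/orP; left; lra.
have ep0 : 0 < e' * p / 4 by rewrite divr_gt0// mulr_gt0.
have oscN delta alpha : `|osc delta alpha| <= 1 by rewrite ger0_norm ?osc_ge0 ?osc_le1.
have [k hk] : exists k, real_outer_expect P' (fun w => osc k.+1%:R^-1 (B w)) <=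
    real_outer_expect P' (fun=> 0) + e' * p / 4.
  apply: (@real_outer_expect_antitone _ _ _ P' N 1) => //.
  - by move=> w; rewrite normr0.
  - by move=> k; apply: BC_linfty_path_measurable => //; exact: osc_BC.
  - move=> k k' w kk'; apply: osc_homo.
    by rewrite lef_pV2 ?posrE// ler_nat.
  - move=> w e1 Nw e10; have [delta [delta0 ta]] := boundary_cont_tame (cB w Nw) e10.
    exists (Num.truncn delta^-1); rewrite add0r.
    apply: le_trans (tame_osc (ltW e10) ta); apply: osc_homo; apply: ltW.
    by rewrite -[ltRHS]invrK ltf_pV2 ?posrE ?invr_gt0// truncnS_gt.
rewrite real_outer_expect_cst add0r in hk.
have [n0 Hn0] := weak_conv_le XB (osc_BC k.+1%:R^-1) ep0.
exists k.+1%:R^-1; split; first by rewrite invr_gt0.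
exists n0 => n /Hn0 hn.
have := @outer_prob_markov _ _ _ P (fun w => osc k.+1%:R^-1 (Xn n w)) e' p.
move=> /(_ _ _ e'0 _) H; apply: le_trans (H _ _ _).
- apply: outer_prob_le => w /= nt; rewrite ltNge; apply/negP => ho; apply: nt.
  have [t1 t2] := osc_tame e'1 ho.
  have ee : e' <= e by rewrite ge_min lexx.
  split=> [q r Dq Dr qr|q Dq nq]; apply: le_trans ee; [exact: t1|exact: t2].
- by exists 1 => w.
- by move=> w; exact: osc_ge0.
- by move: hn hk ep0; lra.
Qed.

End LimitPaths.

(** * Analytic properties of the copula *)

Section ProbabilityIntegralTransform.
Variables (R : realType) (dT : measure_display) (T : measurableType dT).
Variables (P : probability T R) (Y : T -> R).
Hypothesis mY : measurable_fun setT Y.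
Let F (y : R) : R := fine (P [set w | Y w <= y]).
Hypothesis F_continuous : continuous F.

Let mle (Z : T -> R) (y : R) : measurable_fun setT Z -> measurable [set w | Z w <= y].
Proof.
move=> mZ; have := mZ measurableT _ (measurable_itv `]-oo, y]).
by rewrite setTI; congr (measurable _); apply/seteqP; split => w /=; rewrite in_itv.
Qed.

Let FE y : P [set w | Y w <= y] = (F y)%:E.
Proof. by rewrite /F fineK// fin_num_measure//; exact: mle. Qed.

Let F_homo : {homo F : x y / x <= y}.
Proof.
move=> x y xy; rewrite -lee_fin -!FE; apply: le_measure; rewrite ?inE; [exact: mle|exact: mle|].
by move=> w /= h; exact: le_trans h xy.
Qed.

Let F_onto v : 0 < v < 1 -> exists x, F x = v.
Proof.
move=> /andP[v0 v1].
pose Y' : {mfun T >-> R} := HB.pack Y (isMeasurableFun.Build _ _ _ _ Y mY).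
have cdfE x : cdf (Y' : {RV P >-> R}) x = (F x)%:E.
  by rewrite -FE /cdf /distribution /pushforward; congr (P _); apply/seteqP; split => w /=;
    rewrite in_itv.
have [a Fa] : exists a, F a < v.
  have := cvg_cdfNy0 (Y' : {RV P >-> R}).
  move=> /(_ [set x | (x < v%:E)%E]) [|A [_ HA]].
    by apply: open_nbhs_nbhs; split; [exact: open_ereal_lt_ereal|rewrite /= lte_fin].
  exists (A - 1); rewrite -lte_fin -cdfE; apply: HA; lra.
have [b Fb] : exists b, v < F b.
  have := cvg_cdfy1 (Y' : {RV P >-> R}).
  move=> /(_ [set x | (v%:E < x)%E]) [|A [_ HA]].
    by apply: open_nbhs_nbhs; split; [exact: open_ereal_gt_ereal|rewrite /= lte_fin].
  exists (A + 1); rewrite -lte_fin -cdfE; apply: HA; lra.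
have ab : a <= b.
  by rewrite leNgt; apply/negP => /ltW /F_homo; rewrite leNgt (lt_trans Fa Fb).
have cF : {within `[a, b], continuous F} by exact: continuous_subspaceT.
have Fabv : Num.min (F a) (F b) <= v <= Num.max (F a) (F b).
  by rewrite ge_min le_max (ltW Fa) (ltW Fb) orbT.
by have [c _ Fc] := IVT ab cF Fabv; exists c.
Qed.

(** [F] may have flat parts, so the event is squeezed: it contains [Y <= x] when [F x = v], and is
    contained in [Y <= z] when [F z] is slightly above [v]. The levels 0 and 1 need not be attained
    and are handled apart. *)
Lemma probability_integral_transform v : 0 <= v <= 1 ->
  P [set w | F (Y w) <= v] = v%:E.
Proof.
move=> /andP[v0 v1].
have mFY : measurable_fun setT (F \o Y).
  by apply: measurableT_comp => //; exact: continuous_measurable_fun.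
have mA : measurable [set w | F (Y w) <= v] by exact: mle mFY.
have F01 x : 0 <= F x <= 1.
  rewrite -!lee_fin -FE measure_ge0 probability_le1//; exact: mle.
apply/eqP; rewrite eq_le; apply/andP; split.
  have [vlt|v1'] := ltP v 1; last first.
    by apply: le_trans (probability_le1 _ mA) _; rewrite lee_fin.
  apply/lee_addgt0Pr => e e0.
  pose v' := Num.min (v + e) ((v + 1) / 2).
  have [v'1 v'2] : v' <= v + e /\ v' <= (v + 1) / 2 by rewrite !ge_min !lexx orbT.
  have v'v : v < v' by rewrite lt_min ltrDl e0/=; lra.
  have [z Fz] : exists z, F z = v' by apply: F_onto; lra.
  apply: (@le_trans _ _ (P [set w | Y w <= z])).
    apply: le_measure; rewrite ?inE//; first exact: mle.
    move=> w /= Fw; rewrite leNgt; apply/negP => /ltW /F_homo.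
    by rewrite Fz leNgt (le_lt_trans Fw v'v).
  by rewrite FE Fz -EFinD lee_fin.
have [v0'|v0'] := ltP 0 v; last first.
  by have -> : v = 0; [lra|exact: measure_ge0].
have [v1'|v1'] := ltP v 1; last first.
  have -> : [set w | F (Y w) <= v] = setT.
    apply/seteqP; split => // w _ /=; apply: le_trans v1'.
    by case/andP: (F01 (Y w)).
  by have := probability_setT P => ->; rewrite lee_fin.
have [x Fx] : exists x, F x = v by apply: F_onto; rewrite v0'.
rewrite -Fx -FE; apply: le_measure; rewrite ?inE//; first exact: mle.
  by rewrite Fx.
by move=> w /= /F_homo; rewrite Fx.
Qed.

End ProbabilityIntegralTransform.

Lemma setc_id (R : realType) (d : nat) (u : 'rV[R]_d) j : setc u j (u ord0 j) = u.
Proof. by apply/rowP => k; rewrite mxE; case: eqP => [->|]. Qed.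

Lemma setc_setc (R : realType) (d : nat) (u : 'rV[R]_d) j x y :
  setc (setc u j x) j y = setc u j y.
Proof. by apply/rowP => k; rewrite !mxE; case: eqP. Qed.

Lemma setcE (R : realType) (d : nat) (u : 'rV[R]_d) j x : setc u j x ord0 j = x.
Proof. by rewrite mxE eqxx. Qed.

Lemma unit_cube_setc (R : realType) (d : nat) (u : 'rV[R]_d) j x :
  unit_cube u -> 0 <= x <= 1 -> unit_cube (setc u j x).
Proof. by move=> u01 x01 k; rewrite mxE; case: ifP. Qed.

Section Copula.
Variables (R : realType) (d : nat) (dO : measure_display) (Omega : measurableType dO).
Variables (P : probability Omega R) (X : nat -> Omega -> 'rV[R]_d).
Variables (C : 'rV[R]_d -> R) (Cdot : 'I_d -> 'rV[R]_d -> R).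
Hypothesis mX : forall j, measurable_fun setT (fun w => X 1%N w ord0 j).
Hypothesis margin_continuous : forall j : 'I_d, continuous (margin P X j).
Hypothesis C_copula : forall u, unit_cube u -> C u = fine (P [set w | vle (Uvec P X 1 w) u]).
Hypothesis C_derive : forall (j : 'I_d) (u : 'rV[R]_d), unit_cube u -> 0 < u ord0 j < 1 ->
  is_derive (u ord0 j) 1 (fun x => C (setc u j x)) (Cdot j u).
Hypothesis Cdot_continuous : forall j : 'I_d,
  {within [set u | unit_cube u /\ 0 < u ord0 j < 1], continuous (Cdot j)}.
Hypothesis Cdot_boundary : forall (j : 'I_d) (u : 'rV[R]_d),
  (u ord0 j = 0 \/ u ord0 j = 1) -> Cdot j u = 0.

Let U j w : R := margin P X j (X 1%N w ord0 j).

Let measurable_le (Z : Omega -> R) (y : R) : measurable_fun setT Z ->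
  measurable [set w | Z w <= y].
Proof.
move=> mZ; have := mZ measurableT _ (measurable_itv `]-oo, y]).
by rewrite setTI; congr (measurable _); apply/seteqP; split => w /=; rewrite in_itv.
Qed.

Lemma margin01 j x : 0 <= margin P X j x <= 1.
Proof.
have mA := measurable_le x (mX j).
rewrite /margin -!lee_fin fineK ?fin_num_measure//.
by rewrite measure_ge0 probability_le1.
Qed.

Lemma margin_homo j : {homo margin P X j : x y / x <= y}.
Proof.
move=> x y xy; apply: fine_le; rewrite ?fin_num_measure//; try exact: measurable_le.
apply: le_measure; rewrite ?inE; try exact: measurable_le.
by move=> w /= h; exact: le_trans h xy.
Qed.

Let mU j : measurable_fun setT (U j).
Proof.
apply: measurableT_comp (mX j); apply: continuous_measurable_fun.
exact: margin_continuous.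
Qed.

Let U_uniform j v : 0 <= v <= 1 -> P [set w | U j w <= v] = v%:E.
Proof.
by move=> v01; exact: (probability_integral_transform (mX j) (@margin_continuous j) v01).
Qed.

Let vleE u : [set w | vle (Uvec P X 1 w) u] =
  \bigcap_(j in [set: 'I_d]) [set w | U j w <= u ord0 j].
Proof.
apply/seteqP; split => [w /forallP h j _ /=|w h]; first by have := h j; rewrite mxE.
by apply/forallP => j; rewrite mxE; exact: h.
Qed.

Let measurable_vle u : measurable [set w | vle (Uvec P X 1 w) u].
Proof.
rewrite vleE; apply: fin_bigcap_measurable => [|j _]; first exact: finite_finset.
exact: measurable_le.
Qed.

Let CE u : unit_cube u -> P [set w | vle (Uvec P X 1 w) u] = (C u)%:E.
Proof. by move=> u01; rewrite C_copula// fineK// fin_num_measure. Qed.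

Lemma copula01 u : unit_cube u -> 0 <= C u <= 1.
Proof. by move=> u01; rewrite -!lee_fin -CE// measure_ge0 probability_le1. Qed.

Lemma copula_margin u j : unit_cube u -> C (upj u j) = u ord0 j.
Proof.
move=> u01; have uj01 : unit_cube (upj u j) by exact: unit_cube_upj.
have : P [set w | vle (Uvec P X 1 w) (upj u j)] = P [set w | U j w <= u ord0 j].
  congr (P _); rewrite vleE; apply/seteqP; split => [w /(_ j Logic.I)/=|w h k _ /=].
    by rewrite mxE eqxx.
  by rewrite mxE; case: eqP => [->//|_]; case/andP: (margin01 k (X 1%N w ord0 k)).
by rewrite CE// U_uniform// => -[].
Qed.

(** The two events differ only within [x < U_j <= y], which has probability [y - x] by uniformity of
    the margin. *)
Lemma copula_incr u j (x y : R) : unit_cube u -> 0 <= x -> x <= y -> y <= 1 ->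
  0 <= C (setc u j y) - C (setc u j x) <= y - x.
Proof.
move=> u01 x0 xy y1.
have x01 : 0 <= x <= 1 by rewrite x0 (le_trans xy y1).
have y01 : 0 <= y <= 1 by rewrite y1 (le_trans x0 xy).
have cx := unit_cube_setc j u01 x01; have cy := unit_cube_setc j u01 y01.
apply/andP; split.
  rewrite subr_ge0 -lee_fin -!CE//; apply: le_measure; rewrite ?inE//.
  move=> w /= /forallP h; apply/forallP => k; apply: le_trans (h k) _.
  by rewrite !mxE; case: ifP.
have mD : measurable ([set w | U j w <= y] `\` [set w | U j w <= x]).
  by apply: measurableD; exact: measurable_le.
have : (P [set w | vle (Uvec P X 1 w) (setc u j y)] <=
    P [set w | vle (Uvec P X 1 w) (setc u j x)] +
    P ([set w | (U j w <= y)%R] `\` [set w | (U j w <= x)%R]))%E.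
  apply: le_trans (measureU2 _ (measurable_vle _) mD); apply: le_measure; rewrite ?inE//.
    exact: measurableU.
  rewrite !vleE => w h; have [hx|hx] := pselect (U j w <= x); last first.
    by right; split => //; have := h j Logic.I; rewrite /= setcE.
  left => k _ /=; have := h k Logic.I; rewrite /= !mxE.
  by case: eqP => [->|].
have yfin : (P [set w | (U j w <= y)%R] < +oo)%E by rewrite U_uniform// ltry.
have -> : P ([set w | (U j w <= y)%R] `\` [set w | (U j w <= x)%R]) = (y - x)%:E.
  apply: etrans (measureD (measurable_le y (mU j)) (measurable_le x (mU j)) yfin) _.
  rewrite setIidr; last by move=> w /= h; exact: le_trans h xy.
  by rewrite EFinB; congr (_ - _)%E; exact: U_uniform.
by rewrite !CE// -EFinD lee_fin; lra.
Qed.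

Let copula_lip u j (x y : R) : unit_cube u -> 0 <= x <= 1 -> 0 <= y <= 1 ->
  `|C (setc u j x) - C (setc u j y)| <= `|x - y|.
Proof.
move=> u01; wlog xy : x y / x <= y.
  move=> h x01 y01; have [xy|/ltW yx] := leP x y; first exact: h.
  by rewrite distrC [leRHS]distrC; exact: h.
move=> /andP[x0 x1] /andP[y0 y1].
have := copula_incr j u01 x0 xy y1 => /andP[h1 h2].
by rewrite distrC ger0_norm// distrC ger0_norm// subr_ge0.
Qed.

Let derive_setc u j (x : R) : unit_cube u -> 0 < x < 1 ->
  is_derive x 1 (fun z => C (setc u j z)) (Cdot j (setc u j x)).
Proof.
move=> u01 x01; have cx : unit_cube (setc u j x).
  by apply: unit_cube_setc => //; case/andP: x01 => /ltW -> /ltW.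
have x01' : 0 < setc u j x ord0 j < 1 by rewrite setcE.
have := C_derive cx x01'; rewrite setcE.
by under [X in is_derive _ _ X _]funext do rewrite setc_setc.
Qed.

(** Differentiability is used only strictly between [u_j] and [y], hence inside [(0, 1)]; continuity
    up to the endpoints comes from the Lipschitz bound. *)
Lemma copula_mvt u j (y : R) : unit_cube u -> 0 <= y <= 1 -> exists xi : R,
  [/\ `|xi - u ord0 j| <= `|y - u ord0 j|, 0 <= xi <= 1 &
    C (setc u j y) - C u = Cdot j (setc u j xi) * (y - u ord0 j)].
Proof.
move=> u01 y01; have uj01 := u01 j.
have main (a b : R) : 0 <= a -> a <= b -> b <= 1 -> exists2 c, a <= c <= b &
    C (setc u j b) - C (setc u j a) = Cdot j (setc u j c) * (b - a).
  move=> a0 ab b1.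
  have [|||c] := @MVT_segment R (fun z => C (setc u j z)) (fun z => Cdot j (setc u j z)) a b.
  - exact: ab.
  - move=> x; rewrite in_itv/= => /andP[ax xb]; apply: derive_setc => //.
    by rewrite (le_lt_trans a0 ax) (lt_le_trans xb b1).
  - apply/subspace_continuousP => x; rewrite /= in_itv/= => /andP[ax xb].
    apply/cvgrPdist_le => e e0; rewrite /within /=; apply/nbhs_ballP; exists e => //= z xz.
    rewrite in_itv/= => /andP[az zb]; apply: le_trans (copula_lip _ u01 _ _) (ltW xz).
      by rewrite (le_trans a0 ax) (le_trans xb b1).
    by rewrite (le_trans a0 az) (le_trans zb b1).
  - by rewrite in_itv/= => acb E; exists c.
have [uy|/ltW yu] := leP (u ord0 j) y.
  have [c /andP[c1 c2] E] := main _ _ (proj1 (andP uj01)) uy (proj2 (andP y01)).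
  exists c; split; last by rewrite -E setc_id.
    by rewrite !ger0_norm ?subr_ge0// lerD2r.
  by rewrite (le_trans _ c1) ?(le_trans c2)//; [case/andP: y01|case/andP: uj01].
have [c /andP[c1 c2] E] := main _ _ (proj1 (andP y01)) yu (proj2 (andP uj01)).
exists c; split.
- by rewrite !ler0_norm ?subr_le0// lerN2 lerD2r.
- by rewrite (le_trans _ c1) ?(le_trans c2)//; [case/andP: uj01|case/andP: y01].
- by rewrite setc_id in E; rewrite -opprB E -mulrN opprB.
Qed.

Lemma copula_partial_le1 u j : unit_cube u -> `|Cdot j u| <= 1.
Proof.
move=> u01; have uj01 := u01 j.
have [u0|u0] := eqVneq (u ord0 j) 0; first by rewrite Cdot_boundary ?normr0; [|left].
have [u1|u1] := eqVneq (u ord0 j) 1; first by rewrite Cdot_boundary ?normr0; [|right].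
have ujo : 0 < u ord0 j < 1 by rewrite !lt_neqAle eq_sym u0 u1.
have [dC CE'] := C_derive u01 ujo.
apply/ler_addgt0Pr => e e0.
have := dC; rewrite /derivable => /cvg_ex[l Hl].
have El : l = Cdot j u by rewrite -CE' /derive; apply/esym/cvg_lim.
move: Hl => /cvgrPdist_le /(_ e e0); rewrite El => H.
have nearin : \forall h \near (0 : R)^', 0 <= h + u ord0 j <= 1.
  case/andP: ujo => ujp uj1.
  have m0 : 0 < Num.min (u ord0 j) (1 - u ord0 j) by rewrite lt_min ujp subr_gt0.
  apply: nbhs_dnbhs.
  apply/nbhs_ballP; exists (Num.min (u ord0 j) (1 - u ord0 j)) => //= h.
  rewrite /ball /= sub0r normrN lt_min !ltr_norml; lra.
have [h [[Hh hin] hn0]] : exists h : R,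
    (`|Cdot j u - h^-1 *: (C (setc u j (h *: 1 + u ord0 j)) - C (setc u j (u ord0 j)))| <= e
    /\ 0 <= h + u ord0 j <= 1) /\ h != 0.
  near (0 : R)^' => h; exists h; split; [split|]; near: h => //.
  exact: nbhs_dnbhs_neq.
rewrite [h *: 1]mulr1 in Hh.
have q1 : `|h^-1 *: (C (setc u j (h + u ord0 j)) - C (setc u j (u ord0 j)))| <= 1.
  rewrite normrM normfV mulrC ler_pdivrMr ?normr_gt0// mul1r.
  by apply: le_trans (copula_lip j u01 hin uj01) _; rewrite addrK.
by move: Hh q1; rewrite !ler_norml; lra.
Unshelve. all: by end_near.
Qed.

(** The slab where the [j]th coordinate stays in [[eps / 2, 1 - eps / 2]] is compact and avoids the
    faces where continuity may fail; [rho <= eps / 2] keeps [u'] inside it. *)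
Lemma copula_partial_ucont j (eps kappa : R) : 0 < eps -> 0 < kappa ->
  exists rho : R, 0 < rho /\ forall u u', unit_cube u -> unit_cube u' ->
  eps <= u ord0 j <= 1 - eps -> (forall k, `|u ord0 k - u' ord0 k| < rho) ->
  `|Cdot j u - Cdot j u'| <= kappa.
Proof.
move=> eps0 kap0.
pose A (i : 'I_d) : set R := if i == j then `[eps / 2, 1 - eps / 2]%classic else `[0, 1]%classic.
pose K : set 'rV[R]_d := [set v | forall i, A i (v ord0 i)].
have cK : compact K.
  by apply: rV_compact => i; rewrite /A; case: ifP => _; exact: segment_compact.
have KE v : unit_cube v -> eps / 2 <= v ord0 j <= 1 - eps / 2 -> K v.
  by move=> v01 vj i; rewrite /A; case: eqP => [->|_] /=; rewrite in_itv/=.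
have fK : {within K, continuous (Cdot j)}.
  apply: continuous_subspaceW (@Cdot_continuous j) => v Kv /=; split; last first.
    by have := Kv j; rewrite /A eqxx /= in_itv/=; lra.
  move=> i; have := Kv i; rewrite /A; case: eqP => _ /=; rewrite in_itv/=; lra.
have [delta [delta0 H]] := compact_unif_continuous cK fK kap0.
exists (Num.min delta (eps / 2)); split; first by rewrite lt_min delta0 divr_gt0.
move=> u u' u01 u'01 uj uu'.
have [uu1 uu2] : (forall k, `|u ord0 k - u' ord0 k| < delta) /\
    (forall k, `|u ord0 k - u' ord0 k| < eps / 2).
  by split=> k; apply: lt_le_trans (uu' k) _; rewrite ge_min lexx ?orbT.
apply: H; first by apply: KE => //; move: eps0; lra.
  by apply: KE => //; have := uu2 j; rewrite ltr_norml; move: eps0; lra.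
by split => // i k; rewrite (ord1 i); exact: uu1.
Qed.

End Copula.

(** * Boundedness of the processes *)

Section ProcessBounds.
Variables (R : realType) (d : nat) (C : 'rV[R]_d -> R).
Hypothesis C01 : forall u, unit_cube u -> 0 <= C u <= 1.

Let fl_le n (t : R) : t <= 1 -> (fl n t <= n)%N.
Proof.
move=> t1; rewrite -[leqRHS](natrK (R := R)); apply: le_truncn.
exact: ler_piMr.
Qed.

Let norm_sum_le n (a b : nat) (v : nat -> bool) u : unit_cube u -> (b - a <= n)%N ->
  `|(Num.sqrt n%:R)^-1 * \sum_(a <= i < b) ((v i)%:R - C u)| <= (Num.sqrt n%:R)^-1 * n%:R.
Proof.
move=> u01 ban; rewrite normrM ger0_norm ?invr_ge0//; apply: ler_wpM2l; first by rewrite invr_ge0.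
apply: le_trans (ler_norm_sum _ _ _) _.
apply: (@le_trans _ _ (\sum_(a <= i < b) 1)).
  by apply: ler_sum => i _; have := C01 u01; rewrite ler_norml; case: (v i) => /=; lra.
by rewrite sumr_const_nat ler_nat.
Qed.

(** The bound is of order [sqrt n]; it only places each path in the space of bounded functions. *)
Lemma Cn_bounded (T : Type) (X : nat -> T -> 'rV[R]_d) n w : bounded_on D2 (Cn X C n w).
Proof.
exists ((Num.sqrt n%:R)^-1 * n%:R) => -[[s t] u] [/= _ [_ [t1 u01]]].
by apply: norm_sum_le => //; rewrite subSS (leq_trans (leq_subr _ _))//; exact: fl_le.
Qed.

End ProcessBounds.

(** * Lipschitz continuity of the linear map defining the limit *)

Section CmapLipschitz.
Variables (R : realType) (d : nat) (Cdot : 'I_d -> 'rV[R]_d -> R).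
Hypothesis Cdot_le1 : forall u (j : 'I_d), unit_cube u -> `|Cdot j u| <= 1.

Lemma Cmap_lip f g (c : R) : 0 <= c -> (forall p, D1 p -> `|f p - g p| <= c) ->
  forall p, D2 p -> `|Cmap Cdot f p - Cmap Cdot g p| <= (2 + 2 * d%:R) * c.
Proof.
move=> c0 fg [[s t] u] [/= s0 [st [t1 u01]]]; rewrite /Cmap /=.
have s01 : 0 <= s <= 1 by rewrite s0 (le_trans st).
have t01 : 0 <= t <= 1 by rewrite t1 (le_trans s0).
have incr v : unit_cube v -> `|(f (t, v) - f (s, v)) - (g (t, v) - g (s, v))| <= 2 * c.
  move=> v01; have := fg (t, v) (conj t01 v01); have := fg (s, v) (conj s01 v01).
  by rewrite !ler_norml; lra.
have sums : `|\sum_(j < d) Cdot j u * ((f (t, upj u j) - f (s, upj u j)) -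
    (g (t, upj u j) - g (s, upj u j)))| <= 2 * d%:R * c.
  apply: le_trans (ler_norm_sum _ _ _) _.
  have -> : 2 * d%:R * c = \sum_(j < d) 2 * c.
    by rewrite sumr_const card_ord -[RHS]mulr_natl; ring.
  apply: ler_sum => j _; rewrite normrM -[leRHS]mul1r; apply: ler_pM => //.
    exact: Cdot_le1.
  by apply: incr; exact: unit_cube_upj.
rewrite (eq_bigr (fun j => Cdot j u * (f (t, upj u j) - f (s, upj u j)) -
  Cdot j u * (g (t, upj u j) - g (s, upj u j)))) in sums; last by move=> j _; rewrite mulrBr.
rewrite sumrB in sums.
by have := incr u u01; move: sums; rewrite !ler_norml; lra.
Qed.

Lemma Cmap_bounded f : bounded_on D1 f -> bounded_on D2 (Cmap Cdot f).
Proof.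
move=> [M hM]; exists ((2 + 2 * d%:R) * `|M|) => p Dp.
have Z : Cmap Cdot (fun=> 0) p = 0.
  by rewrite /Cmap /= subr0 sub0r big1 ?oppr0// => j _; rewrite mulr0.
rewrite -[Cmap _ _ _]subr0 -Z; apply: Cmap_lip => // q Dq.
by rewrite subr0; apply: le_trans (hM q Dq) (ler_norm _).
Qed.

End CmapLipschitz.

Theorem theorem3p4 (R : realType) (d : nat)
  (dO : measure_display) (Omega : measurableType dO) (P : probability Omega R)
  (X : nat -> Omega -> 'rV[R]_d)
  (C : 'rV[R]_d -> R) (Cdot : 'I_d -> 'rV[R]_d -> R)
  (dO' : measure_display) (Omega' : measurableType dO') (P' : probability Omega' R)
  (BC : Omega' -> R * 'rV[R]_d -> R) :
  (* strictly stationary sequence with continuous margins *)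
  strictly_stationary P X ->
  (forall j : 'I_d, continuous (margin P X j)) ->
  (* C is the copula of X_1, i.e. the distribution function of U_1 *)
  (forall u, unit_cube u -> C u = fine (P [set w | vle (Uvec P X 1 w) u])) ->
  (* (i) *)
  centered_gaussian_process D1 P' BC ->
  (exists N, measurable N /\ P' N = 0%E /\
     forall w, ~ N w -> boundary_cont_set (BC w)) ->
  weak_conv_linfty D1 P (fun n => Btilde (Uvec P X) C n) P' BC ->
  (* (ii) *)
  (forall (j : 'I_d) (u : 'rV[R]_d), unit_cube u -> 0 < u ord0 j < 1 ->
     is_derive (u ord0 j) 1 (fun x => C (setc u j x)) (Cdot j u)) ->
  (forall j : 'I_d,
     {within [set u | unit_cube u /\ 0 < u ord0 j < 1], continuous (Cdot j)}) ->
  (forall (j : 'I_d) (u : 'rV[R]_d), (u ord0 j = 0 \/ u ord0 j = 1) -> Cdot j u = 0) ->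
  (* (iii) *)
  (forall (n : nat) (j : 'I_d), exists N, measurable N /\ P N = 0%E /\
     [set w | exists i i', [/\ (1 <= i <= n)%N, (1 <= i' <= n)%N, i != i' &
                               X i w ord0 j = X i' w ord0 j]] `<=` N) ->
  (* conclusions *)
  sup_cvg_prob0 D2 P
    (fun n w p => Cn X C n w p - Cmap Cdot (Btilde (Uvec P X) C n w) p)
  /\
  weak_conv_linfty D2 P (fun n => Cn X C n) P' (fun w => Cmap Cdot (BC w)).
Proof.
move=> [mX _] cF hC [mBC _] [N [mN [N0 cBC]]] wB dC cC C0 _.
have mX1 j : measurable_fun setT (fun w => X 1%N w ord0 j) by exact: mX.
have C01 := copula01 mX1 cF hC.
have Cle1 := copula_partial_le1 mX1 cF hC dC C0.
have approx (e delta : R) (e0 : 0 < e) (delta0 : 0 < delta) :=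
  @tame_approx R d C Cdot (margin P X) _ _ X (Uvec P X) (margin01 P mX1) (margin_homo P mX1)
    (fun i w j => mxE _ _ _ _) (copula_margin mX1 cF hC) Cle1
    (copula_mvt mX1 cF hC dC) (copula_partial_ucont cC) e delta e0 delta0.
have H1 : sup_cvg_prob0 D2 P
    (fun n w p => Cn X C n w p - Cmap Cdot (Btilde (Uvec P X) C n w) p).
  move=> e e0; apply/fine_cvgP; split.
    apply: nearW => n; rewrite ge0_fin_numE ?outer_prob_ge0//.
    apply: (@le_lt_trans _ _ 1%E); last exact: ltry.
    apply: le_trans (outer_prob_le P (@subsetT _ _)) _.
    by apply: le_trans (outer_prob_le_measure _ measurableT) _; exact: probability_le1.
  apply/cvgrPdist_le => p p0.
  have K0 : 0 < 15 * d%:R + 2 :> R by rewrite ltr_wpDl// mulr_ge0.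
  (* Tameness at this level makes the deterministic error at most [e], so exceeding [e] forces a
     path that is not tame. *)
  have e10 : 0 < e / (15 * d%:R + 2) by rewrite divr_gt0.
  have [delta [delta0 [n1 H1]]] := asymptotically_tame mN N0 mBC cBC wB e10 p0.
  have [n2 H2] := approx _ _ e10 delta0.
  exists (maxn n1 n2) => // n /=; rewrite geq_max => /andP[n1n n2n].
  rewrite sub0r normrN ger0_norm ?fine_ge0 ?outer_prob_ge0//.
  have le_p : (outer_prob P [set w | exists t, D2 t /\ (e < `|Cn X C n w t -
      Cmap Cdot (Btilde (Uvec P X) C n w) t|)%R] <= p%:E)%E.
    apply: le_trans (H1 n n1n); apply: outer_prob_le => w /= [t [Dt et]] tm.
    have := H2 n w n2n tm t Dt; rewrite mulrC divfK ?gt_eqF//.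
    by rewrite leNgt et.
  rewrite -lee_fin fineK// ge0_fin_numE ?outer_prob_ge0//.
  exact: le_lt_trans le_p (ltry _).
split => //.
apply: (@slutsky _ _ _ D1 D2 (Cmap Cdot) (2 + 2 * d%:R) _ _ P _ _ P'
  (fun n => Btilde (Uvec P X) C n) (fun n => Cn X C n) BC N).
- by rewrite addr_ge0// mulr_ge0.
- exact: Cmap_lip.
- exact: Cmap_bounded.
- by move=> n w; exact: (Cn_bounded C01).
- exact: mN.
- exact: N0.
- by move=> w Nw; apply: boundary_cont_bounded; exact: cBC.
- by move=> H; exact: BC_linfty_path_measurable.
- exact: wB.
- exact: H1.
Qed.
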